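(* Let $\Lambda\subseteq\mathbb{R}^d$ be a lattice and let $k$ be a positive integer. Then there are vectors $a_1,\ldots,a_k\in\mathbb{R}^d$, depending only on $\Lambda$ and $k$, such that for every bounded, measurable set $\Omega\subseteq\mathbb{R}^d$ which tiles $\mathbb{R}^d$ multiply at level $k$ with the lattice $\Lambda$, the exponentials $$e^{2\pi i (a_j+\lambda^* )\cdot x},\qquad j=1,2,\ldots,k,\ \lambda^*\in\Lambda^*,$$ (indexed by the pairs $(j,\lambda^* )$) form a Riesz basis for $L^2(\Omega)$.
   Context: A lattice in $\mathbb{R}^d$ is a set $\Lambda=A\mathbb{Z}^d$ with $A$ an invertible real $d\times d$ matrix; its dual lattice is $\Lambda^*=A^{-\top}\mathbb{Z}^d$. A measurable set $\Omega\subseteq\mathbb{R}^d$ tiles $\mathbb{R}^d$ (multiply) at level $k$ with $\Lambda$ if $\sum_{\lambda\in\Lambda}\chi_\Omega(x-\lambda)=k$ for almost every $x\in\mathbb{R}^d$, where $\chi_\Omega$ is the indicator function of $\Omega$ (Lebesgue measure). A countable family of exponentials $e_t(x)=e^{2\pi i t\cdot x}$, $t\in L$, is a Riesz basis for $L^2(\Omega)$ if every $f\in L^2(\Omega)$ can be written uniquely in the form $f(x)=\sum_{t\in L}a_t e^{2\pi i t\cdot x}$ (unconditional convergence in $L^2(\Omega)$, $a_t\in\mathbb{C}$), with the coefficients satisfying $C_1\|f\|_2^2\le\sum_{t\in L}|a_t|^2\le C_2\|f\|_2^2$ for some positive and finite constants $C_1,C_2$ independent of $f$. The constants $C_1,C_2$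 may depend on $\Omega$. *)

(* Defs.v *)
(* MathComp-Analysis, with the complex numbers R[i] of mathcomp-real-closed. *)
From HB Require Import structures.
From mathcomp Require Import all_boot all_order all_algebra finmap.
From mathcomp Require Import all_classical all_reals all_analysis.
From mathcomp Require Import complex.

Set Implicit Arguments.
Unset Strict Implicit.
Unset Printing Implicit Defensive.
Import Order.TTheory GRing.Theory Num.Theory.
Import numFieldNormedType.Exports.

Local Open Scope classical_set_scope.
Local Open Scope ring_scope.

Section lebesgue.
Context (R : realType) (d : nat).
Implicit Types (a b : 'cV[R]_d) (A : set 'cV[R]_d).
Local Open Scope ereal_scope.

Definition box a b : set 'cV[R]_d :=
  [set x | forall i, (a i 0 < x i 0 <= b i 0)%R].

Definition box_vol a b : R := (\prod_(i < d) Num.max 0 (b i 0 - a i 0))%R.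

(* Covers are indexed by a subset of nat, not by nat itself, so that finite
   covers are allowed when d = 0 (there, every box is a point of volume 1). *)
Definition box_cover A : set (set nat * (nat -> 'cV[R]_d * 'cV[R]_d)) :=
  [set c | A `<=` \bigcup_(n in c.1) box (c.2 n).1 (c.2 n).2].

Definition lebesgue_outer A : \bar R :=
  ereal_inf [set \esum_(n in c.1) (box_vol (c.2 n).1 (c.2 n).2)%:E
            | c in box_cover A].

Let box_vol_ge0 a b : 0 <= (box_vol a b)%:E.
Proof. by rewrite lee_fin; apply: prodr_ge0 => i _; rewrite le_max lexx. Qed.

Let lebesgue_outer_ge0 A : 0 <= lebesgue_outer A.
Proof. by apply: le_ereal_inf_tmp => _ [c _ <-]; exact: esum_ge0. Qed.

Let lebesgue_outer0 : lebesgue_outer set0 = 0.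
Proof.
apply/eqP; rewrite eq_le lebesgue_outer_ge0 andbT.
apply: ereal_inf_lbound; exists (set0, fun=> (0, 0)%R) => //=.
exact: esum_set0.
Qed.

Let le_lebesgue_outer : {homo lebesgue_outer : A B / A `<=` B >-> A <= B}.
Proof.
move=> A B AB; apply/ereal_inf_le_tmp => _ [c Bc <-].
by exists c => //; exact: subset_trans AB Bc.
Qed.

Let lebesgue_outer_sigma_subadditive : sigma_subadditive lebesgue_outer.
Proof.
move=> A; have [[i ioo]|] := pselect (exists i, lebesgue_outer (A i) = +oo).
  rewrite (eseries_pinfty _ _ ioo) ?leey// => n _.
  by rewrite -ltNye (lt_le_trans _ (lebesgue_outer_ge0 _)).
rewrite -forallNE => Aoo.
apply/lee_addgt0Pr => e e0.
rewrite (le_trans _ (epsilon_trick _ _ (ltW e0)))//.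
pose w (c : set nat * (nat -> 'cV[R]_d * 'cV[R]_d)) n :=
  (box_vol (c.2 n).1 (c.2 n).2)%:E.
have w0 c n : 0 <= w c n by exact: box_vol_ge0.
have [G PG] : {G : nat -> _ & forall n, box_cover (A n) (G n) /\
    \esum_(m in (G n).1) w (G n) m
      <= lebesgue_outer (A n) + (e / (2 ^ n.+1)%:R)%:E}.
  apply: (@choice _ _ (fun n c => box_cover (A n) c /\
    \esum_(m in c.1) w c m <= lebesgue_outer (A n) + (e / (2 ^ n.+1)%:R)%:E)).
  move=> n.
  have en : (0 < e / (2 ^ n.+1)%:R)%R by rewrite divr_gt0// ltr0n expn_gt0.
  have fA : lebesgue_outer (A n) \is a fin_num.
    by rewrite ge0_fin_numE// ltey; apply/eqP/Aoo.
  have [_ [c Ac <-] /ltW cle] := lb_ereal_inf_adherent en fA.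
  by exists c.
have /card_esym/ppcard_eqP[f] := card_nat2.
pose J := [set p : nat * nat | (G p.1).1 p.2].
pose c := (f @^-1` J, fun n => (G (f n).1).2 (f n).2).
apply: (@le_trans _ _ (\esum_(n in c.1) w c n)).
  apply: ereal_inf_lbound; exists c => // x [n _ /((PG n).1)[m Gm xm]].
  by exists (f^-1%FUN (n, m)); rewrite /c /J/= invK ?inE.
have -> : \esum_(n in c.1) w c n = \esum_(p in J) w (G p.1) p.2.
  rewrite (reindex_esum c.1 J f)//.
  split; [by []|by move=> ? ? _ _; apply: inj; rewrite inE|].
  by move=> p Jp; exists (f^-1%FUN p); rewrite /c /= invK ?inE.
rewrite (_ : J = [set: nat] `*`` (fun n => (G n).1)); last first.
  by apply/seteqP; split=> [[n m]|[n m]] /=; [|case].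
rewrite -(@esum_esum _ _ _ [set: nat] (fun n => (G n).1)
  (fun n m => w (G n) m))//.
rewrite -nneseries_esumT; last by move=> n; exact: esum_ge0.
by apply: lee_nneseries => [n _ _|n _]; [exact: esum_ge0|exact: (PG n).2].
Qed.

HB.instance Definition _ := isOuterMeasure.Build R 'cV[R]_d lebesgue_outer
  lebesgue_outer0 lebesgue_outer_ge0 le_lebesgue_outer
  lebesgue_outer_sigma_subadditive.

(* R^d with the sigma-algebra of Lebesgue-measurable sets. *)
Definition lebesgue_space : Type := caratheodory_type lebesgue_outer.

HB.instance Definition _ := Measurable.copy lebesgue_space
  (caratheodory_type lebesgue_outer).

Definition leb : set lebesgue_space -> \bar R := lebesgue_outer.

HB.instance Definition _ := isMeasure.Build _ lebesgue_space R leb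
  (@caratheodory_measure0 _ _ lebesgue_outer)
  (@caratheodory_measure_ge0 _ _ lebesgue_outer)
  (@caratheodory_measure_sigma_additive _ _ lebesgue_outer).

End lebesgue.
Arguments leb : clear implicits.

Section lattices.
Context (R : realType) (d : nat).

Definition lattice_of (A : 'M[R]_d) : set 'cV[R]_d :=
  [set A *m map_mx intr z | z in [set: 'cV[int]_d]].

Definition is_lattice (L : set 'cV[R]_d) : Prop :=
  exists2 A : 'M[R]_d, A \in unitmx & L = lattice_of A.

Definition is_dual_lattice (L Ls : set 'cV[R]_d) : Prop :=
  exists2 A : 'M[R]_d, A \in unitmx &
    L = lattice_of A /\ Ls = lattice_of (invmx A)^T.

Definition tiles_at_level (k : nat) (L Omega : set 'cV[R]_d) : Prop :=
  {ae leb R d, forall x : 'cV[R]_d,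
    \esum_(l in L) (\1_Omega (x - l) : R)%:E = k%:R%:E}.

End lattices.

Section riesz.
Context (R : realType) (d : nat).
Implicit Types (Omega : set 'cV[R]_d) (f : 'cV[R]_d -> R[i]).

Definition expo (t x : 'cV[R]_d) : R[i] :=
  let theta := 2 * pi * \sum_(i < d) t i 0 * x i 0 in
  (cos theta +i* sin theta)%C.

Definition sqnormc (z : R[i]) : R := ComplexField.Normc.normc z ^+ 2.

Definition sqL2norm Omega f : \bar R :=
  \int[leb R d]_(x in Omega) (sqnormc (f x))%:E.

Definition in_L2 Omega f : Prop :=
  [/\ measurable_fun (Omega : set (lebesgue_space R d)) (@complex.Re R \o f),
      measurable_fun (Omega : set (lebesgue_space R d)) (@complex.Im R \o f)
    & (sqL2norm Omega f < +oo)%E].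

(* Unconditional convergence is convergence of the net of finite partial
   sums. *)
Definition expands_as Omega (I : choiceType) (t : I -> 'cV[R]_d)
    f (a : I -> R[i]) : Prop :=
  forall e : R, 0 < e -> exists F0 : {fset I}, forall F : {fset I},
    (F0 `<=` F)%fset ->
    (sqL2norm Omega (fun x => (f x - \sum_(i <- F) a i * expo (t i) x)%R)
       < e%:E)%E.

Definition exp_riesz_basis Omega (I : choiceType) (t : I -> 'cV[R]_d) : Prop :=
  exists C1 C2 : R, [/\ 0 < C1, 0 < C2 &
    forall f, in_L2 Omega f -> exists a : I -> R[i],
      [/\ expands_as Omega t f a,
          forall b, expands_as Omega t f b -> b = a &
          (C1%:E * sqL2norm Omega f <= \esum_(i in [set: I]) (sqnormc (a i))%:E
             <= C2%:E * sqL2norm Omega f)%E]].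

End riesz.

(* Main.v *)
(* Write L = A Z^d, let D = A [0, 1[^d, and choose v such that
   l |-> e^(2 pi i v.l) is injective on L; put a_j = j v. For almost every x in
   D exactly k points x - l_1, ..., x - l_k of the L-orbit of x lie in Omega, so
   f |-> (f(x - l_m))_m identifies L^2(Omega) with L^2(D)^k. A sum of
   exponentials with frequencies a_j + l^* has the form
   sum_j e^(2 pi i a_j.x) g_j(x) with L-periodic g_j, and under this
   identification (g_j)_j is multiplied by unimodular factors and by the
   Vandermonde matrix with the distinct nodes e^(-2 pi i v.l_m). As Omega is
   bounded, only finitely many such matrices occur, and the theorem reduces to
   the fact that the exponentials with frequencies in L^* form an orthogonal
   basis of L^2(D).

   Orthogonality follows from translation invariance: a suitable translation
   changes the sign of a nontrivial exponential. For completeness, the bounded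
   functions in the L^2-closure of the trigonometric polynomials form an algebra
   closed under bounded pointwise limits. Polynomials converging pointwise to
   the indicator of a half-line show that the sets whose indicator lies in this
   closure form a sigma-algebra for which the coordinates are measurable. Hence
   boxes belong to it, and by outer regularity all measurable sets do. *)

Require Import Defs.
From mathcomp Require Import all_boot all_order all_algebra finmap.
From mathcomp Require Import all_classical all_reals all_analysis.
From mathcomp Require Import measurable_realfun complex zify ring lra.
Import Order.TTheory GRing.Theory Num.Theory.
Import numFieldNormedType.Exports.
Set Implicit Arguments.
Unset Strict Implicit.
Unset Printing Implicit Defensive.
Local Open Scope classical_set_scope.
Local Open Scope ring_scope.

(** * Lebesgue measure on R^d *)

(** The measure is given as an infimum over countable box covers, so even its being nonzero has to
    be proved. This matters because Fourier coefficients are divided by the measure of the cell D: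
    the unit box is shown to have measure at least 1, and a null cell would make it null. Only
    positivity and finiteness of the measure of D enter, and all integrals are moved by
    translations.

    The vector v must separate all of L, not only the translates meeting one given Omega, because it
    is chosen before Omega.

    The Riesz property is reduced to two inequalities for finite exponential sums together with the
    existence of an expansion; uniqueness of the coefficients and both bounds then follow by a
    limit. The two sides of the Vandermonde inverse play different roles. The identity B V = 1
    recovers the periodic components from the values on a fibre and gives the lower inequality. The
    identity V B = 1 produces components for an arbitrary function and gives existence. The upper
    inequality is Cauchy-Schwarz. *)

Section lebesgue_facts.
Context (R : realType) (d : nat).
Implicit Types (a b u x : 'cV[R]_d) (A E : set 'cV[R]_d).
Let T := lebesgue_space R d.
Let mu := leb R d.
Local Open Scope ereal_scope.

Lemma box_vol_ge0 a b : (0 <= box_vol a b)%R.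
Proof. by apply: prodr_ge0 => i _; rewrite le_max lexx. Qed.

Lemma leb_box_le a b : mu (box a b) <= (box_vol a b)%:E.
Proof.
apply: ereal_inf_lbound; exists ([set 0%N], fun=> (a, b)) => /=.
  by move=> x abx; exists 0%N.
by rewrite esum_set1// lee_fin box_vol_ge0.
Qed.

Definition set_coord x (i : 'I_d) (c : R) : 'cV[R]_d :=
  (\col_j (if j == i then c else x j 0))%R.

(** Only the factor of index i changes, and the truncated lengths below and above c add up, also
    when the box is empty or lies on one side of the cut. *)
Lemma box_vol_cut a b (i : 'I_d) (c : R) :
  box_vol a b = (box_vol a (set_coord b i (Num.min (b i 0) c))%R +
                 box_vol (set_coord a i (Num.max (a i 0) c))%R b)%R.
Proof.
rewrite /box_vol (bigD1 i)//= [X in (_ = X + _)%R](bigD1 i)//=.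
rewrite [X in (_ = _ + X)%R](bigD1 i)//= !mxE eqxx.
under [X in (_ = _ * X + _)%R]eq_bigr => j /negPf ji do rewrite mxE ji.
under [X in (_ = _ + _ * X)%R]eq_bigr => j /negPf ji do rewrite mxE ji.
rewrite -mulrDl; congr (_ * _)%R.
set p := a i 0%R; set q := b i 0%R.
rewrite /Num.max /Num.min; repeat case: ifPn; lra.
Qed.

Lemma box_cut_le a b (i : 'I_d) (c : R) :
  box a b `&` [set x | (x i 0 <= c)%R] =
  box a (set_coord b i (Num.min (b i 0) c))%R.
Proof.
apply/seteqP; split=> x.
  move=> [abx /= xc] j; rewrite mxE; case: eqP => [->|_]; last exact: abx.
  by have /andP[-> /=] := abx i; rewrite le_min xc => ->.
move=> /= H; split => [j|].
  have := H j; rewrite mxE; case: eqP => [->|//].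
  by move=> /andP[-> /=]; rewrite le_min => /andP[].
by have := H i; rewrite mxE eqxx le_min => /and3P[].
Qed.

Lemma box_cut_gt a b (i : 'I_d) (c : R) :
  box a b `&` ~` [set x | (x i 0 <= c)%R] =
  box (set_coord a i (Num.max (a i 0) c))%R b.
Proof.
apply/seteqP; split=> x.
  move=> [abx /= /negP]; rewrite -ltNge => xc j.
  rewrite mxE; case: eqP => [->|_]; last exact: abx.
  by have /andP[? ->] := abx i; rewrite gt_max xc andbT; apply/andP.
move=> /= H; split => [j|].
  have := H j; rewrite mxE; case: eqP => [->|//].
  by move=> /andP[+ ->]; rewrite gt_max => /andP[->].
apply/negP; rewrite -ltNge.
by have := H i; rewrite mxE eqxx gt_max => /andP[/andP[]].
Qed.

(** Cutting every box of a cover of X along the hyperplane gives covers of both parts of X with the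
    same total volume. This is the nontrivial inequality in the Carathéodory criterion. *)
Lemma halfspace_measurable (i : 'I_d) (c : R) :
  measurable ([set x | (x i 0 <= c)%R] : set T).
Proof.
apply: le_caratheodory_measurable => /= X.
apply: le_ereal_inf_tmp => _ [C CX <-].
have -> : \esum_(n in C.1) (box_vol (C.2 n).1 (C.2 n).2)%:E =
   \esum_(n in C.1) (box_vol (C.2 n).1
       (set_coord (C.2 n).2 i (Num.min ((C.2 n).2 i 0) c))%R)%:E +
   \esum_(n in C.1) (box_vol
       (set_coord (C.2 n).1 i (Num.max ((C.2 n).1 i 0) c))%R (C.2 n).2)%:E.
  rewrite -esumD; last 2 first.
    by move=> n _; rewrite lee_fin box_vol_ge0.
    by move=> n _; rewrite lee_fin box_vol_ge0.
  by apply: eq_esum => n _; rewrite -EFinD -box_vol_cut.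
apply: leeD; apply: ereal_inf_lbound.
  exists (C.1, fun n => ((C.2 n).1,
     set_coord (C.2 n).2 i (Num.min ((C.2 n).2 i 0%R) c))) => //=.
  move=> x [/CX[n Cn xn] xc]; exists n => //=.
  by rewrite -box_cut_le.
exists (C.1, fun n => (set_coord (C.2 n).1 i (Num.max ((C.2 n).1 i 0%R) c),
    (C.2 n).2)) => //=.
move=> x [/CX[n Cn xn] xc]; exists n => //=.
by rewrite -box_cut_gt.
Qed.

Lemma measurable_coord (i : 'I_d) (D : set T) :
  measurable_fun D (fun x : T => (x : 'cV[R]_d) i 0%R).
Proof.
apply: measurable_funTS.
apply: (measurability _ (RGenOInfty.measurableE R)) => //.
move=> _ [_ [c ->] <-]; rewrite setTI.
rewrite (_ : _ @^-1` _ = ~` [set x : 'cV[R]_d | (x i 0 <= c)%R]).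
  exact/measurableC/halfspace_measurable.
by apply/seteqP; split=> x /=; rewrite in_itv /= andbT ltNge => /negP.
Qed.

Lemma box_measurable a b : measurable (box a b : set T).
Proof.
rewrite (_ : box a b = \bigcap_(i in [set: 'I_d])
   ([set x : 'cV[R]_d | (x i 0 <= b i 0)%R] `&`
    ~` [set x : 'cV[R]_d | (x i 0 <= a i 0)%R])).
  apply: fin_bigcap_measurable => [|i _]; first exact: finite_finset.
  by apply: measurableI; [|apply: measurableC]; exact: halfspace_measurable.
apply/seteqP; split=> x /=.
  move=> abx i _ /=.
  by have /andP[? ?] := abx i; split => //; apply/negP; rewrite -ltNge.
move=> H i; have [? /negP] := H i Logic.I.
by rewrite -ltNge => ->.
Qed.

(** Outer regularity is built into the definition by covers; the outer set is a countable union of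
    boxes. *)
Lemma leb_approx (E : set T) (e : R) : mu E < +oo -> (0 < e)%R ->
  exists c : set nat * (nat -> 'cV[R]_d * 'cV[R]_d),
    E `<=` \bigcup_(n in c.1) box (c.2 n).1 (c.2 n).2 /\
    mu (\bigcup_(n in c.1) box (c.2 n).1 (c.2 n).2) <= mu E + e%:E.
Proof.
move=> fE e0.
have fE' : mu E \is a fin_num by rewrite ge0_fin_numE.
have [_ [c Ec <-] /ltW cle] := lb_ereal_inf_adherent e0 fE'.
exists c; split => //; apply: le_trans cle.
by apply: ereal_inf_lbound; exists c.
Qed.

Lemma outer_translate u A :
  lebesgue_outer [set x | A (x - u)%R] = lebesgue_outer A.
Proof.
have H (v : 'cV[R]_d) (B : set 'cV[R]_d) : lebesgue_outer [set x | B (x - v)%R] <= lebesgue_outer B.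
  apply: le_ereal_inf_tmp => _ [c cB <-].
  apply: ereal_inf_lbound.
  exists (c.1, fun n => ((c.2 n).1 + v, (c.2 n).2 + v)%R) => /=.
    move=> x /cB[n cn xn]; exists n => //= i.
    by have := xn i; rewrite !mxE ltrBrDr lerBlDr.
  apply: eq_esum => n _; congr EFin; apply: eq_bigr => i _.
  by rewrite !mxE opprD addrACA subrr addr0.
apply/eqP; rewrite eq_le H /=.
have := H (- u)%R [set x | A (x - u)%R].
by congr (_ <= _); congr lebesgue_outer; apply/seteqP; split=> x /=;
  rewrite opprK addrK.
Qed.

(** Translating the test set X by -u turns the Carathéodory criterion for the preimage of B into the
    criterion for B itself. *)
Lemma measurable_translate u :
  measurable_fun setT (fun x : T => (x - u)%R : T).
Proof.
move=> _ B mB; rewrite setTI.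
suff : forall X, lebesgue_outer X = lebesgue_outer (X `&` [set x | B (x - u)%R])
  + lebesgue_outer (X `&` ~` [set x | B (x - u)%R]) by [].
have {}mB : forall X, lebesgue_outer X = lebesgue_outer (X `&` B)
  + lebesgue_outer (X `&` ~` B) by exact: mB.
move=> X.
rewrite -(outer_translate (- u) X) -(outer_translate (- u) (X `&` _)).
rewrite -(outer_translate (- u) (X `&` ~` _)).
rewrite mB; congr (_ + _); congr lebesgue_outer.
  by apply/seteqP; split=> x /=; rewrite opprK addrK.
by apply/seteqP; split=> x /=; rewrite opprK addrK.
Qed.

Lemma measurable_fun_translate d' (U : measurableType d') (G : T -> U) u
    (D : set T) :
  measurable_fun setT G -> measurable_fun D (fun x : T => G (x - u)%R).
Proof.
move=> mG.
exact: (measurableT_comp mG (measurable_funTS (measurable_translate u))).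
Qed.

Lemma ge0_integral_translate u (E : set T) (f : T -> \bar R) :
  measurable E -> measurable_fun E f -> (forall x, E x -> 0 <= f x) ->
  \int[mu]_(x in [set x : T | E (x - u)%R]) f (x - u)%R =
  \int[mu]_(x in E) f x.
Proof.
move=> mE mf f0.
transitivity (\int[pushforward mu (fun x : T => (x - u)%R : T)]_(x in E) f x).
  rewrite (ge0_integral_pushforward (measurable_translate u)) //.
  by move=> y /[!inE]; exact: f0.
have mt := measurable_translate u.
apply: (@eq_measure_integral _ T R E (leb R d)) => A mA _.
exact: outer_translate.
Qed.

(** * Lower bound for the measure of the unit box *)

Let integral_itv_indic (c a b : R) : (0 <= c)%R ->
  \int[@lebesgue_measure R]_(t in [set: measurableTypeR R])
    (c * (\1_(`]a, b]%classic : set R) t))%:E =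
  (c * Num.max 0 (b - a))%:E.
Proof.
move=> c0; pose I : set (measurableTypeR R) := `]a, b]%classic.
have mI : measurable I by exact: measurable_itv.
transitivity (c%:E * \int[lebesgue_measure]_t (\1_I t)%:E).
  rewrite -ge0_integralZl_EFin//.
  by apply/measurable_EFinP; apply: measurable_indic.
rewrite integral_indic// setIT EFinM; congr (_ * _).
transitivity (@lebesgue_measure R `]a, b]%classic); first by [].
rewrite lebesgue_measure_itv/= lte_fin.
by rewrite -EFinB /Num.max subr_gt0; case: ifP.
Qed.

(* Integrating the indicators of a cover one coordinate after the other
   replaces, step by step, each box by its volume. *)
Lemma box_cover_vol (c : set nat * (nat -> 'cV[R]_d * 'cV[R]_d)) (j : nat) :
  box (0 : 'cV[R]_d)%R (const_mx 1%R) `<=`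
    \bigcup_(n in c.1) box (c.2 n).1 (c.2 n).2 ->
  forall x : 'I_d -> R,
  (\prod_(i < d) (if (i < j)%N then 1 else \1_(`]0, 1]%classic : set R) (x i)))%R%:E
  <= \sum_(n <oo) (\1_(c.1) n * \prod_(i < d)
       (if (i < j)%N then Num.max 0 ((c.2 n).2 i 0 - (c.2 n).1 i 0)
        else \1_(`](c.2 n).1 i 0, (c.2 n).2 i 0]%classic : set R) (x i)))%R%:E.
Proof.
move=> cP; elim: j => [|j IH] x.
  have nn n : 0 <= (\1_(c.1) n * \prod_(i < d)
     (\1_(`](c.2 n).1 i 0, (c.2 n).2 i 0]%classic : set R) (x i)))%R%:E :> \bar R.
    by rewrite lee_fin mulr_ge0 ?indic_ge0//; apply: prodr_ge0.
  have [H|/existsNP[i Hi]] := pselect (forall i, x i \in `]0%R, 1%R]); last first.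
    rewrite (bigD1 i)//= indicE memNset// mul0r.
    by apply: nneseries_ge0 => n _ _; exact: nn.
  rewrite big1; last by move=> i _ /=; rewrite indicE mem_set//; exact: H.
  have [|n cn xn] := cP (\col_i x i)%R.
    by move=> i; rewrite !mxE; have := H i; rewrite in_itv.
  rewrite (@nneseriesD1 _ _ n)//=.
  apply: (@le_trans _ _ 1%:E) => //.
  rewrite -[leLHS]adde0; apply: leeD; last first.
    by apply: nneseries_ge0 => m _ _; exact: nn.
  rewrite lee_fin indicE mem_set// mul1r big1// => i _.
  rewrite indicE mem_set//=; have := xn i.
  by rewrite mxE in_itv.
have [dj|jd] := leqP d j.
  have jE (i : 'I_d) : (i < j.+1)%N = (i < j)%N.
    by rewrite ltnS leq_eqVlt; case: eqP => //= E; move: (ltn_ord i); rewrite E ltnNge dj.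
  move: (IH x); under eq_bigr do rewrite -jE.
  move=> /le_trans; apply; apply: lee_nneseries => n _ //.
    rewrite lee_fin mulr_ge0 ?indic_ge0//; apply: prodr_ge0 => i _.
    by case: ifP => // _; rewrite le_max lexx.
  by under eq_bigr do rewrite -jE.
pose i0 := Ordinal jd.
pose q : R := (\prod_(i < d | i != i0)
    (if (i < j)%N then 1 else \1_(`]0, 1]%classic : set R) (x i)))%R.
pose p n : R := (\1_(c.1) n * \prod_(i < d | i != i0)
       (if (i < j)%N then Num.max 0 ((c.2 n).2 i 0 - (c.2 n).1 i 0)
        else \1_(`](c.2 n).1 i 0, (c.2 n).2 i 0]%classic : set R) (x i)))%R.
have jE (i : 'I_d) : i != i0 -> (i < j.+1)%N = (i < j)%N.
  move=> ii0; rewrite ltnS leq_eqVlt; case: eqP => //= E.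
  by case/eqP: ii0; apply: val_inj.
have p0 n : (0 <= p n)%R.
  rewrite mulr_ge0 ?indic_ge0//; apply: prodr_ge0 => i _.
  by case: ifP => // _; rewrite le_max lexx.
pose I n : set R := ([set` `](c.2 n).1 i0 0, (c.2 n).2 i0 0]])%R.
(* The induction hypothesis, with all coordinates but the j-th frozen, is an inequality between
   functions of t. Integrating it in t replaces the indicators of index j by lengths. *)
have {}IH (t : R) : (q * \1_(`]0, 1]%classic : set R) t)%:E <=
    \sum_(n <oo) (p n * \1_(I n) t)%:E.
  have := IH (fun i => if i == i0 then t else x i).
  congr (_ <= _).
    rewrite (bigD1 i0)//= ltnn eqxx mulrC; congr (_ * _)%:E.
    by apply: eq_bigr => i /negPf ->.
  apply: eq_eseriesr => n _; congr EFin.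
  rewrite (bigD1 i0)//= ltnn eqxx mulrCA [RHS]mulrC; congr (_ * (_ * _))%R.
  by apply: eq_bigr => i /negPf ->.
have mI n (c' : R) : measurable_fun [set: measurableTypeR R]
    (fun t => (c' * \1_(I n) t)%:E).
  apply/measurable_EFinP; apply: measurable_funM; first exact: measurable_cst.
  by apply: measurable_indic; exact: measurable_itv.
have q0 : (0 <= q)%R by apply: prodr_ge0 => i _; case: ifP.
have : \int[@lebesgue_measure R]_t (q * \1_(`]0, 1]%classic : set R) t)%:E <=
    \int[@lebesgue_measure R]_t \sum_(n <oo) (p n * \1_(I n) t)%:E.
  apply: ge0_le_integral.
  - exact: measurableT.
  - by move=> t _; rewrite lee_fin mulr_ge0.
  - apply/measurable_EFinP; apply: measurable_funM; first exact: measurable_cst.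
    by apply: measurable_indic; exact: measurable_itv.
  - apply: ge0_emeasurable_sum => [n t _ _|n _]; last exact: mI.
    by rewrite lee_fin mulr_ge0.
  - by move=> t _; exact: IH.
rewrite integral_nneseries//; last by move=> n t _; rewrite lee_fin mulr_ge0.
rewrite integral_itv_indic// subr0 /Num.max ltr01 mulr1.
congr (_ <= _).
  congr EFin; rewrite [RHS](bigD1 i0)//= ltnSn mul1r.
  by apply: eq_bigr => i /jE ->.
apply: eq_eseriesr => n _; rewrite integral_itv_indic//; congr EFin.
rewrite [in RHS](bigD1 i0)//= ltnSn.
rewrite [in RHS]mulrCA [RHS]mulrC; congr (_ * _ * _)%R.
by apply: eq_bigr => i /jE ->.
Qed.

(** At j = d all coordinates have been integrated out of [box_cover_vol]: the left side is 1, the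
    right side is the total volume of the cover, and the point x is irrelevant. *)
Lemma leb_unit_box : 1 <= mu (box (0 : 'cV[R]_d)%R (const_mx 1%R)).
Proof.
apply: le_ereal_inf_tmp => _ [c cB <-].
have := box_cover_vol d cB (fun=> 0%R).
rewrite big1 => [|i _]; last by rewrite ltn_ord.
move=> /le_trans; apply.
rewrite esum_mkcond -nneseries_esumT; last first.
  by move=> n; case: ifP => // _; rewrite lee_fin box_vol_ge0.
apply: lee_nneseries => n _ //.
  rewrite lee_fin mulr_ge0//; apply: prodr_ge0 => i _.
  by rewrite ltn_ord le_max lexx.
rewrite indicE; case: ifP => _; last by rewrite mul0r.
by rewrite mul1r lee_fin le_eqVlt; apply/orP; left; apply/eqP;
  apply: eq_bigr => i _; rewrite ltn_ord.
Qed.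

End lebesgue_facts.

(** * Complex exponentials *)

Section complex_facts.
Context (R : realType).
Implicit Types (z w : R[i]) (r s : R).

Lemma sqnormcE z : sqnormc z = complex.Re z ^+ 2 + complex.Im z ^+ 2.
Proof.
by case: z => a b; rewrite /sqnormc /= sqr_sqrtr// addr_ge0// sqr_ge0.
Qed.

Lemma sqnormc_ge0 z : 0 <= sqnormc z.
Proof. exact: sqr_ge0. Qed.

Lemma sqnormc0 : sqnormc (0 : R[i]) = 0.
Proof. by rewrite sqnormcE /= expr0n addr0. Qed.

Lemma sqnormc_eq0 z : sqnormc z = 0 -> z = 0.
Proof. by move/eqP; rewrite sqrf_eq0 => /eqP/ComplexField.Normc.eq0_normc. Qed.

Lemma sqnormcM z w : sqnormc (z * w) = sqnormc z * sqnormc w.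
Proof. by rewrite /sqnormc ComplexField.Normc.normcM exprMn. Qed.

Lemma sqnormcN z : sqnormc (- z) = sqnormc z.
Proof. by rewrite !sqnormcE; case: z => a b /=; rewrite !sqrrN. Qed.

Lemma sqnormcD_le z w : sqnormc (z + w) <= 2 * sqnormc z + 2 * sqnormc w.
Proof.
rewrite !sqnormcE; case: z w => [a b] [c e] /=.
have := sqr_ge0 (a - c); have := sqr_ge0 (b - e); rewrite !expr2; lra.
Qed.

(* Cauchy-Schwarz, by induction from
   |x + y|^2 <= (1 + n) |x|^2 + (1 + 1/n) |y|^2. *)
Lemma sqnormc_sum_le (I : Type) (s : seq I) (F : I -> R[i]) :
  sqnormc (\sum_(i <- s) F i) <= (size s)%:R * \sum_(i <- s) sqnormc (F i).
Proof.
elim: s => [|i s IH]; first by rewrite !big_nil sqnormc0 mul0r.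
rewrite !big_cons /=.
set z := F i; set w := \sum_(j <- s) F j; set S := \sum_(j <- s) _.
have S0 : 0 <= S by apply: sumr_ge0 => j _; exact: sqnormc_ge0.
have [s0|s_gt0] := posnP (size s).
  have -> : w = 0 by rewrite /w (size0nil s0) big_nil.
  by rewrite addr0 s0 mul1r lerDl.
have n0 : (0 < (size s)%:R :> R) by rewrite ltr0n.
move: IH; rewrite -/w -/S -[(size s).+1]addn1 natrD.
set n : R := (size s)%:R in n0 *.
rewrite !sqnormcE; case: z w => [a b] [c e] /= IH.
have H (x y : R) : (x + y) ^+ 2 <= x ^+ 2 + y ^+ 2 + n * x ^+ 2 + n^-1 * y ^+ 2.
  rewrite -subr_ge0.
  have -> : x ^+ 2 + y ^+ 2 + n * x ^+ 2 + n^-1 * y ^+ 2 - (x + y) ^+ 2 =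
     n * (x - n^-1 * y) ^+ 2 by field; rewrite gt_eqF.
  by rewrite mulr_ge0 ?sqr_ge0// ltW.
have := H a c; have := H b e.
have : n^-1 * (c ^+ 2 + e ^+ 2) <= S.
  by rewrite mulrC ler_pdivrMr// mulrC.
nra.
Qed.

Definition cis r : R[i] := (cos r +i* sin r)%C.

Lemma cis0 : cis 0 = 1.
Proof. by rewrite /cis cos0 sin0. Qed.

Lemma cisD r s : cis (r + s) = cis r * cis s.
Proof.
rewrite /cis cosD sinD; apply/eqP; rewrite eq_complex /=.
by rewrite eqxx /= addrC.
Qed.

Lemma sqnormc_cis r : sqnormc (cis r) = 1.
Proof. by rewrite sqnormcE /= cos2Dsin2. Qed.

Lemma cis_neq0 r : cis r != 0.
Proof.
by apply/eqP => H; have := sqnormc_cis r; rewrite H sqnormc0 => /eqP;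
  rewrite eq_sym oner_eq0.
Qed.

Lemma cis_pi : cis pi = -1.
Proof.
by rewrite /cis cospi sinpi; apply/eqP; rewrite eq_complex /= oppr0 !eqxx.
Qed.

Lemma cis_nat (n : nat) : cis (2 * pi * n%:R) = 1.
Proof.
elim: n => [|n IH]; first by rewrite mulr0 cis0.
rewrite -[n.+1]addn1 natrD mulrDr cisD IH mul1r mulr1 mulr_natl mulr2n cisD cis_pi.
by rewrite mulrNN mulr1.
Qed.

Lemma cis_int (m : int) : cis (2 * pi * m%:~R) = 1.
Proof.
case: m => n; first exact: cis_nat.
rewrite NegzE mulrNz mulrN.
apply: (mulIf (cis_neq0 (2 * pi * n.+1%:~R))).
by rewrite -cisD addNr cis0 mul1r cis_nat.
Qed.

(** Let s be the fractional part of r. One of 2 pi s and 2 pi (1 - s) lies in [0, pi], where cos is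
    injective, and has cosine 1. In the first case s = 0; in the second s = 1, which is excluded. *)
Lemma cis_eq1 r : cis (2 * pi * r) = 1 -> exists m : int, r = m%:~R.
Proof.
move=> H; exists (Num.floor r).
have pi0 := pi_gt0 R.
set f := Num.floor r.
suff /eqP : r - f%:~R = 0 by rewrite subr_eq0 => /eqP.
have : cis (2 * pi * (r - f%:~R)) = 1.
  rewrite mulrBr cisD H mul1r.
  by rewrite -mulrN -mulrNz cis_int.
have s0 : 0 <= r - f%:~R by rewrite subr_ge0 floor_le_tmp.
have s1 : r - f%:~R < 1 by rewrite ltrBlDl -intrD1 lt_succ_floor.
move: s0 s1; set s := r - _ => s0 s1 [] cs ss.
have [s12|s12] := leP s (2^-1).
  have /(@cos_inj R) : cos (2 * pi * s) = cos 0 by rewrite cs cos0.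
  rewrite !in_itv/= lexx (ltW pi0) => /(_ _ isT).
  have -> : 0 <= 2 * pi * s <= pi by apply/andP; split; nra.
  by move=> /(_ isT); nra.
have /(@cos_inj R) : cos (2 * pi * (1 - s)) = cos 0.
  rewrite mulrBr mulr1 -(cosN (_ - _)) opprB cosB cs ss mul0r addr0 mul1r cos0.
  by have := cis_nat 1; rewrite mulr1 => -[].
rewrite !in_itv/= lexx (ltW pi0) => /(_ _ isT).
have -> : 0 <= 2 * pi * (1 - s) <= pi by apply/andP; split; nra.
by move=> /(_ isT); nra.
Qed.

End complex_facts.

(** * The pairing on R^d and its characters *)

Section dot.
Context (R : realType) (d : nat).
Implicit Types (t x y : 'cV[R]_d).

Definition dot t x : R := \sum_(i < d) t i 0 * x i 0.

Lemma dotE t x : dot t x = (t^T *m x) 0 0.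
Proof. by rewrite mxE; apply: eq_bigr => i _; rewrite mxE. Qed.

Lemma dotC t x : dot t x = dot x t.
Proof. by apply: eq_bigr => i _; rewrite mulrC. Qed.

Lemma dotDr t x y : dot t (x + y) = dot t x + dot t y.
Proof. by rewrite !dotE mulmxDr mxE. Qed.

Lemma dotZr (c : R) t x : dot t (c *: x) = c * dot t x.
Proof. by rewrite !dotE -scalemxAr mxE. Qed.

Lemma dotNr t x : dot t (- x) = - dot t x.
Proof. by rewrite -scaleN1r dotZr mulN1r. Qed.

Lemma dot_mulmxr (A : 'M[R]_d) t x : dot t (A *m x) = dot (A^T *m t) x.
Proof. by rewrite !dotE trmx_mul trmxK mulmxA. Qed.

Lemma expoE t x : expo t x = cis (2 * pi * dot t x).
Proof. by []. Qed.

Lemma expoC t x : expo t x = expo x t.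
Proof. by rewrite !expoE dotC. Qed.

Lemma expoDr t x y : expo t (x + y) = expo t x * expo t y.
Proof. by rewrite !expoE dotDr mulrDr cisD. Qed.

Lemma expoDl t x y : expo (t + x) y = expo t y * expo x y.
Proof. by rewrite expoC expoDr !(expoC y). Qed.

Lemma expo0l x : expo 0 x = 1.
Proof. by rewrite expoC expoE -(scale0r x) dotZr mul0r mulr0 cis0. Qed.

Lemma sqnormc_expo t x : sqnormc (expo t x) = 1.
Proof. exact: sqnormc_cis. Qed.

Lemma expo_neq0 t x : expo t x != 0.
Proof. exact: cis_neq0. Qed.

Lemma expoNl t x : expo (- t) x = (expo t x)^-1.
Proof.
by apply: (mulIf (expo_neq0 t x)); rewrite -expoDl addNr expo0l mulVf ?expo_neq0.
Qed.

Lemma expo_conj t x : (expo t x)^*%C = expo (- t) x.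
Proof. by rewrite !expoE [dot (- t) x]dotC dotNr mulrN (dotC x) /cis cosN sinN. Qed.

Lemma expoZnl (n : nat) t x : expo (n%:R *: t) x = expo t x ^+ n.
Proof.
elim: n => [|n IH]; first by rewrite scale0r expo0l expr0.
by rewrite -natr1 scalerDl scale1r expoDl IH exprSr.
Qed.

End dot.

(** * The fundamental cell of a lattice *)

Section lattice_cell.
Context (R : realType) (d : nat) (A : 'M[R]_d).
Hypothesis uA : A \in unitmx.
Implicit Types (x y u : 'cV[R]_d) (z m : 'cV[int]_d).
Let T := lebesgue_space R d.
Let mu : {measure set T -> \bar R} := leb R d.

Definition lat z : 'cV[R]_d := A *m map_mx intr z.
Definition crd x : 'cV[R]_d := invmx A *m x.
Definition cell : set 'cV[R]_d := [set x | forall i, 0 <= crd x i 0 < 1].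
(** The index of the lattice translate of [cell] that contains x. *)
Definition zfl x : 'cV[int]_d := \col_i Num.floor (crd x i 0).

Lemma latN z : lat (- z) = - lat z.
Proof. by rewrite /lat map_mxN mulmxN. Qed.

Lemma crd_lat z : crd (lat z) = map_mx intr z.
Proof. by rewrite /crd /lat mulKmx. Qed.

Lemma lat_inj : injective lat.
Proof.
move=> z m /(congr1 crd); rewrite !crd_lat => /matrixP E.
by apply/matrixP => i j; have := E i j; rewrite !mxE => /eqP; rewrite eqr_int => /eqP.
Qed.

Lemma crd_latE z i : crd (lat z) i 0 = (z i 0)%:~R.
Proof. by rewrite crd_lat mxE. Qed.

Lemma crdBE x y i : crd (x - y) i 0 = crd x i 0 - crd y i 0.
Proof. by rewrite /crd mulmxBr mxE [X in _ + X]mxE. Qed.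

Lemma zflE x i : zfl x i 0 = Num.floor (crd x i 0).
Proof. by rewrite mxE. Qed.

Lemma zfl_subl x z : zfl (x - lat z) = zfl x - z.
Proof.
apply/colP => i; rewrite zflE crdBE crd_latE -mulrNz floorDrz ?intr_int//.
by rewrite intrKfloor -zflE [RHS]mxE [X in _ = _ + X]mxE.
Qed.

Lemma cellP x : cell x <-> zfl x = 0.
Proof.
split=> [cx|/colP zx i].
  apply/colP => i; rewrite zflE [RHS]mxE; apply: floor_def.
  by rewrite add0r; exact: cx.
have := zx i; rewrite zflE [X in _ = X]mxE => zxi.
by have := floor_itv (crd x i 0); rewrite zxi add0r.
Qed.

Lemma cell_subl x z : cell (x - lat z) <-> zfl x = z.
Proof.
rewrite cellP zfl_subl; split=> [/eqP|->]; last by rewrite subrr.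
by rewrite subr_eq0 => /eqP.
Qed.

Lemma measurable_crd (i : 'I_d) :
  measurable_fun setT (fun x : T => crd x i 0).
Proof.
rewrite (_ : (fun x : T => crd x i 0) =
  (fun x : T => \sum_j invmx A i j * (x : 'cV[R]_d) j 0)); last first.
  by apply/funext => x; rewrite /crd mxE.
apply: measurable_sum => j; apply: measurable_funM; first exact: measurable_cst.
exact: measurable_coord.
Qed.

Lemma measurable_cell : measurable (cell : set T).
Proof.
rewrite (_ : cell = \bigcap_(i in [set: 'I_d])
    ((fun x : T => crd x i 0) @^-1` `[0, 1[%classic)).
  apply: fin_bigcap_measurable => [|i _]; first exact: finite_finset.
  rewrite -[X in measurable X]setTI.
  exact: (measurable_crd i measurableT (measurable_itv `[0, 1[)).
apply/seteqP; split=> x.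
  by move=> cx i _ /=; rewrite in_itv; exact: cx.
by move=> cx i; have := cx i I; rewrite /= in_itv.
Qed.

Definition crd_bounded (E : set 'cV[R]_d) :=
  exists N : nat, forall x, E x -> forall i, `|crd x i 0| <= N%:R.

(** Floors of bounded coordinates take finitely many values. The sign is the one of the unfolding
    formula: if x is in the cell, then [zfl] of x - lat m is -m. *)
Lemma crd_bounded_finite E : crd_bounded E ->
  exists2 s : seq 'cV[int]_d, uniq s & forall x, E x -> - zfl x \in s.
Proof.
move=> [N EN].
pose g (v : 'cV['I_(N.+1 + N).+1]_d) : 'cV[int]_d :=
  \col_i ((v i 0 : nat)%:Z - N%:Z).
exists (undup [seq g v | v : 'cV['I_(N.+1 + N).+1]_d]); first exact: undup_uniq.
move=> x /EN xN; rewrite mem_undup.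
have H i : exists k : 'I_(N.+1 + N).+1, - zfl x i 0 = (k : nat)%:Z - N%:Z.
  rewrite zflE; have := xN i; set y := crd x i 0; rewrite ler_norml => /andP[y1 y2].
  have f1 : - Num.floor y <= N%:Z + 1.
    by rewrite -(lerN2 _ (- _)) opprK floor_ge_int mulrNz intrD;
       apply: le_trans y1; rewrite lerN2 lerDl.
  have f2 : - N%:Z <= - Num.floor y.
    rewrite lerN2 -ltzD1 floor_lt_int intrD; apply: le_lt_trans y2 _.
    by rewrite ltrDl.
  have f3 : 0 <= - Num.floor y + N%:Z by lia.
  have [k Hk] : exists k : nat, - Num.floor y + N%:Z = k%:Z.
    by case: (_ + _) f3 => // k _; exists k.
  have kN : (k < (N.+1 + N).+1)%N by lia.
  by exists (Ordinal kN) => /=; lia.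
have [k kP] := choice H.
apply/mapP; exists (\col_i k i); first by rewrite mem_enum.
by apply/colP => i; rewrite mxE [RHS]mxE mxE kP.
Qed.

Lemma crd_norm_le (B : 'M[R]_d) x (M : R) : (forall i, `|x i 0| <= M) ->
  forall i, `|(B *m x) i 0| <= M * \sum_i \sum_j `|B i j|.
Proof.
move=> xM i.
have M0 : 0 <= M by apply: le_trans (xM i); exact: normr_ge0.
rewrite mxE; apply: (le_trans (ler_norm_sum _ _ _)).
apply: (@le_trans _ _ (\sum_j `|B i j| * M)).
  by apply: ler_sum => j _; rewrite normrM ler_wpM2l.
rewrite -mulr_suml mulrC ler_wpM2l// [leRHS](bigD1 i)//= lerDl.
by apply: sumr_ge0 => *; apply: sumr_ge0.
Qed.

Let nat_ub (K : R) : exists N : nat, K <= N%:R.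
Proof.
by exists (Num.bound `|K|); rewrite ltW// (le_lt_trans (ler_norm _))// archi_boundP.
Qed.

Lemma bounded_crd_bounded (E : set 'cV[R]_d) : bounded_set E -> crd_bounded E.
Proof.
move=> [M [_ /(_ (M + 1))]]; rewrite ltrDl ltr01 => /(_ isT) EM.
pose K := (M + 1) * \sum_i \sum_j `|invmx A i j|.
have [N KN] := nat_ub K; exists N => x Ex i; apply: le_trans KN.
apply: crd_norm_le => j.
have /= := EM _ Ex; apply: le_trans.
rewrite /Num.norm/= mx_normrE.
exact: (le_bigmax _ (fun ij : 'I_d * 'I_1 => `|x ij.1 ij.2|) (j, 0)).
Qed.

Lemma crd_bounded_cellD u : crd_bounded [set x | cell (x - u)].
Proof.
pose K := 1 + \sum_i `|crd u i 0|.
have [N KN] := nat_ub K; exists N => x cx i; apply: le_trans KN.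
have := cx i; rewrite crdBE => /andP[c0 c1].
rewrite -[X in `|X|](subrK (crd u i 0)).
apply: (le_trans (ler_normD _ _)); apply: lerD.
  by rewrite ger0_norm// ltW.
by rewrite (bigD1 i)//= lerDl; exact: sumr_ge0.
Qed.

Local Open Scope ereal_scope.

Lemma cell_finite : mu cell < +oo.
Proof.
pose M := (1 * \sum_i \sum_j `|A i j|)%R.
(* Boxes are open on the lower side, so the lower corner is moved down by 1. *)
apply: (@le_lt_trans _ _ (mu (box (const_mx (- M - 1)%R) (const_mx M)))).
  apply: le_measure; rewrite ?inE; [exact: measurable_cell|exact: box_measurable|].
  move=> x cx i; rewrite !mxE.
  have : (`|(A *m crd x) i 0| <= M)%R.
    apply: crd_norm_le => j; have /andP[c0 c1] := cx j.
    by rewrite ger0_norm// ltW.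
  rewrite /crd mulKVmx// ler_norml => /andP[x1 x2].
  by rewrite x2 andbT; apply: lt_le_trans x1; rewrite ltrBlDr ltrDl.
apply: le_lt_trans (leb_box_le _ _) _; exact: ltry.
Qed.

(** The lattice translates of the cell partition the space, and those indexed by s carry G. The
    integral over each of them is translated back to the cell. *)
Lemma ge0_integral_unfold (G : T -> \bar R) (s : seq 'cV[int]_d) :
  measurable_fun setT G -> (forall x, 0 <= G x) -> uniq s ->
  (forall x, (- zfl x)%R \notin s -> G x = 0) ->
  \int[mu]_x G x = \int[mu]_(x in cell) \sum_(m <- s) G (x - lat m)%R.
Proof.
move=> mG G0 us sG.
pose D m : set T := [set x | cell (x + lat m)%R].
have DE m : D m = [set x | zfl x = (- m)%R].
  by apply/seteqP; split=> x; rewrite /D /= -{1}(opprK (lat m)) -latN;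
    move/cell_subl.
have mD m : measurable (D m).
  have -> : D m = setT `&` (fun x : T => (x - lat (- m))%R : T) @^-1` cell.
    by rewrite setTI; apply/seteqP; split=> x; rewrite /D /= latN opprK.
  exact: (measurable_translate (lat (- m)) measurableT measurable_cell).
rewrite (ge0_integral_sum mu measurable_cell); first last.
- by move=> m x _; exact: G0.
- by move=> m; exact: measurable_fun_translate.
transitivity (\int[mu]_x \sum_(m <- s) (G \_ (D m)) x).
  apply: eq_integral => x _.
  have [xs|xs] := boolP ((- zfl x)%R \in s); last first.
    rewrite sG// big1_seq// => m /= ms; rewrite patchE ifF//.
    apply/negbTE; rewrite notin_setE DE /= => E.
    by move: xs; rewrite E opprK ms.
  rewrite (bigD1_seq _ xs us)/= patchE ifT; last by rewrite inE DE/= opprK.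
  rewrite big1 ?adde0// => m mx; rewrite patchE ifF//.
  by apply/negbTE; rewrite notin_setE DE /= => E; move: mx; rewrite E opprK eqxx.
rewrite (ge0_integral_sum mu measurableT); first last.
- by move=> m x _; rewrite patchE; case: ifP.
- by move=> m; apply/(measurable_restrictT _ (mD m)); exact: measurable_funTS.
apply: eq_bigr => m _; rewrite -integral_mkcond.
rewrite -(@ge0_integral_translate _ _ (lat m))//; last exact: measurable_funTS.
by congr integral; apply/seteqP; split=> x; rewrite /D /= subrK.
Qed.

(** If the cell were null, unfolding would make the integral of the indicator of the unit box
    vanish, against [leb_unit_box]. *)
Lemma cell_gt0 : 0 < mu cell.
Proof.
rewrite lt0e measure_ge0 andbT; apply/eqP => D0.
pose B := box (0 : 'cV[R]_d)%R (const_mx 1%R).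
have bB : crd_bounded B.
  pose K := (1 * \sum_i \sum_j `|invmx A i j|)%R.
  have [N KN] := nat_ub K; exists N => x Bx i; apply: le_trans KN.
  apply: crd_norm_le => j; have := Bx j; rewrite !mxE => /andP[x0 x1].
  by rewrite ger0_norm// ltW.
have [s us sB] := crd_bounded_finite bB.
have mB : measurable (B : set T) by exact: box_measurable.
pose G : T -> \bar R := fun x => (\1_B x)%:E.
have mG : measurable_fun setT G.
  by apply/measurable_EFinP; exact: measurable_indic.
have G0 x : 0 <= G x by rewrite lee_fin.
have Gs x : (- zfl x)%R \notin s -> G x = 0.
  by move=> xs; rewrite /G indicE memNset// => Bx; move: xs; rewrite sB.
have : 1 <= \int[mu]_x G x.
  by rewrite (integral_indic mu measurableT mB) setIT; exact: leb_unit_box.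
rewrite (ge0_integral_unfold mG G0 us Gs) null_set_integral.
- by rewrite leNgt lte01.
- exact: measurable_cell.
- by apply: emeasurable_sum => m; exact: measurable_fun_translate.
- exact: D0.
Qed.

(** The left side is the integral of f over the cell shifted by -u. Unfolding it over the original
    cell, each x has exactly one lattice translate in the shifted cell, and there f has the value f
    x by periodicity. *)
Lemma integral_cell_periodic (f : T -> \bar R) u :
  measurable_fun setT f -> (forall x, 0 <= f x) ->
  (forall x z, f (x - lat z)%R = f x) ->
  \int[mu]_(x in cell) f (x - u)%R = \int[mu]_(x in cell) f x.
Proof.
move=> mf f0 fp.
pose E : set T := [set x | cell (x - (- u))%R].
have mE : measurable E.
  have -> : E = setT `&` (fun x : T => (x - (- u))%R : T) @^-1` cell.
    by rewrite setTI.
  exact: (measurable_translate (- u) measurableT measurable_cell).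
have [s us sE] := crd_bounded_finite (crd_bounded_cellD (- u)).
transitivity (\int[mu]_(x in E) f x).
  rewrite -(@ge0_integral_translate _ _ u E f)//; last exact: measurable_funTS.
  by congr integral; apply/seteqP; split=> x; rewrite /E /= opprK subrK.
rewrite integral_mkcond (ge0_integral_unfold _ _ us); first last.
- move=> x xs; rewrite patchE ifF//; apply/negbTE; rewrite notin_setE => Ex.
  by move: xs; rewrite sE.
- by move=> x; rewrite patchE; case: ifP.
- by apply/(measurable_restrictT _ mE); exact: measurable_funTS.
apply: eq_integral => x /[!inE] cx.
pose m0 := zfl (x + u)%R.
have Em m : E (x - lat m)%R <-> m0 = m.
  by rewrite /E /= opprK addrAC; exact: cell_subl.
have m0s : m0 \in s.
  have : E (x - lat m0)%R by apply/Em.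
  by move=> /sE; rewrite zfl_subl; move/cellP: cx => ->; rewrite add0r opprK.
rewrite (bigD1_seq _ m0s us)/= patchE ifT; last by rewrite inE; apply/Em.
rewrite big1 ?adde0// => m mm0; rewrite patchE ifF//.
by apply/negbTE; rewrite notin_setE => /Em E'; move: mm0; rewrite E' eqxx.
Qed.

End lattice_cell.

(** * Square-integrable complex functions and Fourier coefficients *)

Section complex_measurable.
Context d (T : measurableType d) (R : realType).
Variables (mu : {measure set T -> \bar R}) (D : set T).
Hypothesis mD : measurable D.
Implicit Types (f g : T -> R[i]).

Lemma ReD (z w : R[i]) : complex.Re (z + w) = complex.Re z + complex.Re w.
Proof. by case: z w => [a b] [c e]. Qed.
Lemma ImD (z w : R[i]) : complex.Im (z + w) = complex.Im z + complex.Im w.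
Proof. by case: z w => [a b] [c e]. Qed.
Lemma ReM (z w : R[i]) : complex.Re (z * w) =
  complex.Re z * complex.Re w - complex.Im z * complex.Im w.
Proof. by case: z w => [a b] [c e]. Qed.
Lemma ImM (z w : R[i]) : complex.Im (z * w) =
  complex.Re z * complex.Im w + complex.Im z * complex.Re w.
Proof. by case: z w => [a b] [c e]. Qed.

Definition cmeas f := measurable_fun D (fun x => complex.Re (f x)) /\
  measurable_fun D (fun x => complex.Im (f x)).

Lemma cmeas_cst (c : R[i]) : cmeas (fun=> c).
Proof. by split; exact: measurable_cst. Qed.

Lemma cmeasD f g : cmeas f -> cmeas g -> cmeas (fun x => f x + g x).
Proof.
move=> [f1 f2] [g1 g2]; split.
  by under eq_fun do rewrite ReD; exact: measurable_funD.
by under eq_fun do rewrite ImD; exact: measurable_funD.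
Qed.

Lemma cmeasM f g : cmeas f -> cmeas g -> cmeas (fun x => f x * g x).
Proof.
move=> [f1 f2] [g1 g2]; split.
  by under eq_fun do rewrite ReM; apply: measurable_funB; exact: measurable_funM.
by under eq_fun do rewrite ImM; apply: measurable_funD; exact: measurable_funM.
Qed.

Lemma cmeasN f : cmeas f -> cmeas (fun x => - f x).
Proof.
move=> mf; under eq_fun do rewrite -mulN1r.
by apply: cmeasM => //; exact: cmeas_cst.
Qed.

Lemma cmeasB f g : cmeas f -> cmeas g -> cmeas (fun x => f x - g x).
Proof. by move=> mf mg; apply: cmeasD => //; exact: cmeasN. Qed.

Lemma cmeas_conj f : cmeas f -> cmeas (fun x => (f x)^*%C).
Proof.
move=> [f1 f2]; split.
  by rewrite (_ : (fun x => _) = (fun x => complex.Re (f x)))//;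
    apply/funext => x; case: (f x).
rewrite (_ : (fun x => _) = (fun x => - complex.Im (f x))).
  exact: measurable_funN.
by apply/funext => x; case: (f x).
Qed.

Lemma cmeas_sum (I : Type) (s : seq I) (F : I -> T -> R[i]) :
  (forall i, cmeas (F i)) -> cmeas (fun x => \sum_(i <- s) F i x).
Proof.
move=> mF; elim: s => [|i s IH].
  by under eq_fun do rewrite big_nil; exact: cmeas_cst.
by under eq_fun do rewrite big_cons; exact: cmeasD.
Qed.

Lemma cmeas_real (h : T -> R) : measurable_fun D h -> cmeas (fun x => (h x)%:C%C).
Proof. by move=> mh; split => //=; exact: measurable_cst. Qed.

Lemma measurable_sqnormc f : cmeas f ->
  measurable_fun D (fun x => (sqnormc (f x))%:E).
Proof.
move=> [f1 f2]; apply/measurable_EFinP.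
under eq_fun do rewrite sqnormcE.
by apply: measurable_funD; exact: measurable_funX.
Qed.

(** The square of the norm; this is why the substitutes for the triangle inequality below carry
    factors 2. *)
Definition normL2 f : \bar R := (\int[mu]_(x in D) (sqnormc (f x))%:E)%E.

Lemma normL2_ge0 f : (0 <= normL2 f)%E.
Proof. by apply: integral_ge0 => x _; rewrite lee_fin sqnormc_ge0. Qed.

Lemma normL2_le f g (M : R) : cmeas f -> cmeas g -> 0 <= M ->
  (forall x, D x -> sqnormc (f x) <= M * sqnormc (g x)) ->
  (normL2 f <= M%:E * normL2 g)%E.
Proof.
move=> mf mg M0 fg; rewrite /normL2 -ge0_integralZl_EFin//; first last.
- exact: measurable_sqnormc.
- by move=> x _; rewrite lee_fin sqnormc_ge0.
apply: ge0_le_integral.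
- exact: mD.
- by move=> x _; rewrite lee_fin sqnormc_ge0.
- exact: measurable_sqnormc.
- by apply: measurable_funeM; exact: measurable_sqnormc.
- by move=> x Dx; rewrite -EFinM lee_fin fg.
Qed.

Lemma normL2D_le f g : cmeas f -> cmeas g ->
  (normL2 (fun x => (f x + g x)%R) <= 2%:E * normL2 f + 2%:E * normL2 g)%E.
Proof.
move=> mf mg; rewrite /normL2.
have F0 (h : T -> R[i]) x : D x -> (0 <= (sqnormc (h x))%:E)%E.
  by rewrite lee_fin sqnormc_ge0.
rewrite -!ge0_integralZl_EFin//; try exact: F0; try exact: measurable_sqnormc.
rewrite -ge0_integralD//; first last.
- by apply: measurable_funeM; exact: measurable_sqnormc.
- by move=> x Dx; rewrite mule_ge0// F0.
- by apply: measurable_funeM; exact: measurable_sqnormc.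
- by move=> x Dx; rewrite mule_ge0// F0.
apply: ge0_le_integral.
- exact: mD.
- exact: F0.
- by apply: measurable_sqnormc; exact: cmeasD.
- by apply: emeasurable_funD; apply: measurable_funeM; exact: measurable_sqnormc.
- by move=> x _; rewrite -!EFinM -EFinD lee_fin sqnormcD_le.
Qed.

Lemma normL2N f : normL2 (fun x => - f x) = normL2 f.
Proof. by apply: eq_integral => x _; rewrite sqnormcN. Qed.

Lemma normL2B_le f g : cmeas f -> cmeas g ->
  (normL2 (fun x => (f x - g x)%R) <= 2%:E * normL2 f + 2%:E * normL2 g)%E.
Proof. by move=> mf mg; rewrite -(normL2N g); apply: normL2D_le => //; exact: cmeasN. Qed.

Definition L2 f := cmeas f /\ (normL2 f < +oo)%E.

Lemma L2D f g : L2 f -> L2 g -> L2 (fun x => f x + g x).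
Proof.
move=> [mf f2] [mg g2]; split; first exact: cmeasD.
apply: le_lt_trans (normL2D_le mf mg) _.
by rewrite lte_add_pinfty// lte_mul_pinfty.
Qed.

Lemma L2Ml f g (M : R) : cmeas f -> (forall x, D x -> sqnormc (f x) <= M) ->
  L2 g -> L2 (fun x => f x * g x).
Proof.
move=> mf fM [mg g2]; split; first exact: cmeasM.
(* M may be negative when D is empty. *)
have M0 : 0 <= Num.max 0 M by rewrite le_max lexx.
apply: (@le_lt_trans _ _ ((Num.max 0 M)%:E * normL2 g)%E).
  apply: normL2_le => //; first exact: cmeasM.
  move=> x Dx; rewrite sqnormcM ler_wpM2r ?sqnormc_ge0//.
  by rewrite le_max fM ?orbT.
by rewrite lte_mul_pinfty// ltW.
Qed.

Lemma L2N f : L2 f -> L2 (fun x => - f x).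
Proof. by move=> [mf f2]; split; [exact: cmeasN|rewrite normL2N]. Qed.

Lemma L2B f g : L2 f -> L2 g -> L2 (fun x => f x - g x).
Proof. by move=> f2 g2; apply: L2D => //; exact: L2N. Qed.

Hypothesis fD : (mu D < +oo)%E.

Lemma L2_bounded f (M : R) : cmeas f -> (forall x, D x -> sqnormc (f x) <= M) ->
  L2 f.
Proof.
move=> mf fM.
have one2 : L2 (fun=> 1).
  split; first exact: cmeas_cst.
  rewrite /normL2 (_ : (fun x => _) = cst 1%E) ?integral_cst ?mul1e//.
  by apply/funext => x; rewrite sqnormcE /= expr1n expr0n addr0.
by have := L2Ml mf fM one2; under eq_fun do rewrite mulr1.
Qed.

(** Both parts are dominated by 1 + |f|^2, which is integrable as D has finite measure. *)
Lemma L2_integrable f : L2 f ->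
  mu.-integrable D (EFin \o (fun x => complex.Re (f x))) /\
  mu.-integrable D (EFin \o (fun x => complex.Im (f x))).
Proof.
move=> [mf f2].
have Ig : mu.-integrable D (EFin \o (fun x => 1 + sqnormc (f x))).
  apply/integrableP; split.
    apply/measurable_EFinP; apply: measurable_funD; first exact: measurable_cst.
    by apply/measurable_EFinP; exact: measurable_sqnormc.
  under eq_integral => x _.
    rewrite gee0_abs; last by rewrite lee_fin addr_ge0 ?ler01 ?sqnormc_ge0.
    rewrite /= EFinD; over.
  rewrite ge0_integralD//; first last.
  - exact: measurable_sqnormc.
  - by move=> x _; rewrite lee_fin sqnormc_ge0.
  - by rewrite integral_cst// mul1e lte_add_pinfty.
have sq_le (a b : R) : `|a| <= 1 + (a ^+ 2 + b ^+ 2).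
  have := sqr_ge0 b; have : `|a| ^+ 2 = a ^+ 2 by rewrite real_normK// num_real.
  have := sqr_ge0 (`|a| - 1); rewrite !expr2; nra.
case: mf => m1 m2; split; apply: le_integrable Ig => //.
- exact/measurable_EFinP.
- move=> x Dx; rewrite /= lee_fin [leRHS]ger0_norm ?addr_ge0 ?ler01 ?sqnormc_ge0//.
  by rewrite sqnormcE.
- exact/measurable_EFinP.
- move=> x Dx; rewrite /= lee_fin [leRHS]ger0_norm ?addr_ge0 ?ler01 ?sqnormc_ge0//.
  by rewrite sqnormcE [X in 1 + X]addrC.
Qed.

Let integrable_scale (r : R) (h : T -> R) : mu.-integrable D (EFin \o h) ->
  mu.-integrable D (EFin \o (fun x => r * h x)).
Proof. exact: integrableZl. Qed.

Let integrable_add (h k : T -> R) : mu.-integrable D (EFin \o h) ->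
  mu.-integrable D (EFin \o k) -> mu.-integrable D (EFin \o (fun x => h x + k x)).
Proof. exact: integrableD. Qed.

Let integrable_sub (h k : T -> R) : mu.-integrable D (EFin \o h) ->
  mu.-integrable D (EFin \o k) -> mu.-integrable D (EFin \o (fun x => h x - k x)).
Proof. exact: integrableB. Qed.

Lemma integrable_const (r : R) : mu.-integrable D (EFin \o (fun=> r)).
Proof.
have := @L2_bounded (fun=> r%:C%C) (sqnormc r%:C%C) (cmeas_cst _).
by move=> /(_ (fun _ _ => lexx _))/L2_integrable[].
Qed.

Definition cint f : R[i] :=
  ((\int[mu]_(x in D) complex.Re (f x))%R +i* (\int[mu]_(x in D) complex.Im (f x))%R)%C.

Lemma cintB f g : L2 f -> L2 g -> cint (fun x => f x - g x) = cint f - cint g.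
Proof.
move=> /L2_integrable[f1 f2] /L2_integrable[g1 g2].
have ReB (z w : R[i]) : complex.Re (z - w) = complex.Re z - complex.Re w.
  by case: z w => [a b] [c e].
have ImB (z w : R[i]) : complex.Im (z - w) = complex.Im z - complex.Im w.
  by case: z w => [a b] [c e].
apply/eqP; rewrite eq_complex /=; apply/andP; split; apply/eqP.
  by under eq_Rintegral do rewrite ReB; exact: RintegralB.
by under eq_Rintegral do rewrite ImB; exact: RintegralB.
Qed.

Lemma cintZ (c : R[i]) f : L2 f -> cint (fun x => c * f x) = c * cint f.
Proof.
move=> /L2_integrable[f1 f2].
apply/eqP; rewrite eq_complex /=; apply/andP; split; apply/eqP; rewrite ?ReM ?ImM /=.
  under eq_Rintegral do rewrite ReM.
  by rewrite RintegralB// ?RintegralZl//; exact: integrable_scale.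
under eq_Rintegral do rewrite ImM.
by rewrite RintegralD// ?RintegralZl//; exact: integrable_scale.
Qed.

Definition rnormL2 f : R := (\int[mu]_(x in D) sqnormc (f x))%R.

Lemma rnormL2E f : L2 f -> normL2 f = (rnormL2 f)%:E.
Proof.
by move=> [mf f2]; rewrite /rnormL2 /Rintegral fineK// ge0_fin_numE ?normL2_ge0.
Qed.

Lemma sqnormc_integrable f : L2 f ->
  mu.-integrable D (EFin \o (fun x => sqnormc (f x))).
Proof.
move=> [mf f2]; apply/integrableP; split; first exact: measurable_sqnormc.
under eq_integral do rewrite /= ger0_norm ?sqnormc_ge0//.
exact: f2.
Qed.

(** * Expansions in an orthogonal family of unimodular functions *)

Section fourier.
Context (Z : eqType) (e : Z -> T -> R[i]).
Hypothesis me : forall z, cmeas (e z).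
Hypothesis e1 : forall z x, sqnormc (e z x) = 1.
Let c := fine (mu D).
Hypothesis c0 : 0 < c.
Hypothesis e_orth : forall z s, z != s -> cint (fun x => e z x * (e s x)^*%C) = 0.

Lemma sqnormc_conj (z : R[i]) : sqnormc (z^*%C) = sqnormc z.
Proof. by rewrite !sqnormcE; case: z => a b /=; rewrite sqrrN. Qed.

Lemma e_L2 z : L2 (e z).
Proof. by apply: (@L2_bounded _ 1) => // x _; rewrite e1. Qed.

Lemma L2_mul_conj f z : L2 f -> L2 (fun x => f x * (e z x)^*%C).
Proof.
move=> f2; under eq_fun do rewrite mulrC.
apply: (@L2Ml _ _ 1) => //; first exact: cmeas_conj.
by move=> x _; rewrite sqnormc_conj e1.
Qed.

Lemma L2Z (b : R[i]) f : L2 f -> L2 (fun x => b * f x).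
Proof.
by move=> f2; apply: (@L2Ml _ _ (sqnormc b)) => //; exact: cmeas_cst.
Qed.

(** Every [e z] has squared norm c, the measure of D, hence the factor 1/c. *)
Definition coef f z : R[i] := (c^-1)%:C%C * cint (fun x => f x * (e z x)^*%C).

Definition trig_sum (b : Z -> R[i]) (F : seq Z) (x : T) : R[i] :=
  \sum_(z <- F) b z * e z x.

Lemma trig_sum_L2 b F : L2 (trig_sum b F).
Proof.
elim: F => [|z F IH].
  rewrite (_ : trig_sum _ _ = fun=> 0); last first.
    by apply/funext => x; rewrite /trig_sum big_nil.
  by apply: (@L2_bounded _ 0); [exact: cmeas_cst|move=> x _; rewrite sqnormc0].
rewrite (_ : trig_sum _ _ = fun x => b z * e z x + trig_sum b F x); last first.
  by apply/funext => x; rewrite /trig_sum big_cons.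
by apply: L2D => //; apply: L2Z; exact: e_L2.
Qed.

Lemma coef_sub_trig f b F s : L2 f -> s \notin F ->
  coef (fun x => f x - trig_sum b F x) s = coef f s.
Proof.
move=> f2; elim: F => [|z F IH] in f f2 *.
  by move=> _; rewrite /coef; congr (_ * cint _); apply/funext => x;
    rewrite /trig_sum big_nil subr0.
rewrite inE negb_or => /andP[sz sF].
have -> : (fun x => f x - trig_sum b (z :: F) x) =
    fun x => (f x - b z * e z x) - trig_sum b F x.
  by apply/funext => x; rewrite /trig_sum big_cons opprD addrA.
have be2 : L2 (fun x => b z * e z x) by apply: L2Z; exact: e_L2.
rewrite IH//; last exact: L2B.
rewrite /coef; congr (_ * _).
have -> : (fun x => (f x - b z * e z x) * (e s x)^*%C) =
   (fun x => f x * (e s x)^*%C - b z * (e z x * (e s x)^*%C)).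
  by apply/funext => x; rewrite mulrBl mulrA.
rewrite cintB ?cintZ; first by rewrite e_orth 1?eq_sym// mulr0 subr0.
- by apply: L2_mul_conj; exact: e_L2.
- exact: L2_mul_conj.
- by apply: L2Z; apply: L2_mul_conj; exact: e_L2.
Qed.

(** Completing the square: since |e z| = 1, |f - b e|^2 = |f|^2 - 2 Re (conj b w) + |b|^2 with w = f
    conj e, and the integral of w is c times the coefficient. *)
Lemma rnormL2_sub1 f (b : R[i]) z : L2 f ->
  rnormL2 (fun x => f x - b * e z x) =
  rnormL2 f - c * sqnormc (coef f z) + c * sqnormc (coef f z - b).
Proof.
move=> f2; pose w x := f x * (e z x)^*%C.
have wL2 : L2 w by exact: L2_mul_conj.
have [w1 w2] := L2_integrable wL2.
rewrite /rnormL2.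
have -> : (\int[mu]_(x in D) sqnormc (f x - b * e z x) =
    \int[mu]_(x in D) ((sqnormc (f x) - ((2 * complex.Re b) * complex.Re (w x) +
       (2 * complex.Im b) * complex.Im (w x)))
       + sqnormc b))%R.
  apply: eq_Rintegral => x _; rewrite /w; move: (e1 z x).
  rewrite !sqnormcE; case: b (f x) (e z x) => [b1 b2] [f1 f2'] [g1 g2] /= E.
  move: E; rewrite !expr2 => E.
  have -> : b1 * b1 + b2 * b2 = (b1 * b1 + b2 * b2) * (g1 * g1 + g2 * g2).
    by rewrite E mulr1.
  ring.
have i1 := integrable_scale (2 * complex.Re b) w1.
have i2 := integrable_scale (2 * complex.Im b) w2.
have i3 : mu.-integrable D (EFin \o (fun x => (2 * complex.Re b) * complex.Re (w x) +
       (2 * complex.Im b) * complex.Im (w x))) by exact: integrable_add.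
have i4 : mu.-integrable D (EFin \o (fun x => sqnormc (f x) -
    ((2 * complex.Re b) * complex.Re (w x) + (2 * complex.Im b) * complex.Im (w x)))).
  by apply: integrable_sub => //; exact: sqnormc_integrable.
have i5 : mu.-integrable D (EFin \o (fun=> sqnormc b)).
  exact: integrable_const.
rewrite RintegralD// Rintegral_cst// RintegralB//; last exact: sqnormc_integrable.
rewrite RintegralD// !RintegralZl// -/c.
have W : cint w = c%:C%C * coef f z.
  rewrite /coef mulrA -rmorphM mulfV ?gt_eqF//= .
  by rewrite mul1r.
rewrite !sqnormcE; case: (coef f z) W => [a1 a2] /eqP.
rewrite eq_complex /= !mul0r subr0 addr0 => /andP[/eqP -> /eqP ->].
case: b {i1 i2 i3 i4 i5} => [b1 b2] /=; ring.
Qed.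

(** One frequency is split off at a time; by orthogonality, subtracting the others leaves its
    coefficient unchanged. *)
Lemma rnormL2_sub f b F : L2 f -> uniq F ->
  rnormL2 (fun x => f x - trig_sum b F x) =
  rnormL2 f - c * \sum_(z <- F) sqnormc (coef f z)
            + c * \sum_(z <- F) sqnormc (coef f z - b z).
Proof.
move=> f2; elim: F => [_|z F IH /= /andP[zF uF]].
  rewrite !big_nil mulr0 subr0 addr0; congr rnormL2.
  by apply/funext => x; rewrite /trig_sum big_nil subr0.
have -> : (fun x => f x - trig_sum b (z :: F) x) =
    fun x => (f x - trig_sum b F x) - b z * e z x.
  by apply/funext => x; rewrite /trig_sum big_cons opprD addrA addrAC.
rewrite rnormL2_sub1; last by apply: L2B => //; exact: trig_sum_L2.
rewrite coef_sub_trig// IH// !big_cons; ring.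
Qed.

(** This is [rnormL2_sub] for f = 0, all of whose coefficients vanish. *)
Lemma parseval b F : uniq F ->
  rnormL2 (trig_sum b F) = c * \sum_(z <- F) sqnormc (b z).
Proof.
move=> uF.
have z2 : L2 (fun=> 0).
  by apply: (@L2_bounded _ 0); [exact: cmeas_cst|move=> x _; rewrite sqnormc0].
have co0 z : coef (fun=> 0) z = 0.
  rewrite /coef (_ : (fun x => _) = fun=> 0).
    by rewrite /cint !Rintegral_cst// !mul0r mulr0.
  by apply/funext => x; rewrite mul0r.
have := rnormL2_sub b z2 uF.
have -> : rnormL2 (fun=> 0) = 0.
  rewrite /rnormL2; under eq_Rintegral do rewrite sqnormc0.
  by rewrite Rintegral_cst// mul0r.
under [in X in _ = X -> _]eq_bigr do rewrite co0 sqnormc0.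
rewrite big1// mulr0 subr0 add0r.
under [in X in _ = X -> _]eq_bigr do rewrite co0 sub0r sqnormcN.
by move=> <-; apply: eq_Rintegral => x _; rewrite sub0r sqnormcN.
Qed.

(* The Fourier coefficients give the best approximation on every finite set of
   frequencies, hence density of the span already yields convergence of the net
   of partial sums. *)
Lemma fourier_converges f :
  (forall eps : R, 0 < eps -> exists b F,
     uniq F /\ (normL2 (fun x => (f x - trig_sum b F x)%R) < eps%:E)%E) ->
  L2 f ->
  forall eps : R, 0 < eps -> exists2 F0, uniq F0 &
    forall F, uniq F -> {subset F0 <= F} ->
    (normL2 (fun x => (f x - trig_sum (coef f) F x)%R) < eps%:E)%E.
Proof.
move=> dense f2 eps eps0; have [b [F0 [uF0 fb]]] := dense _ eps0.
exists F0 => // F uF F0F.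
(* Extended by 0, the approximating sum runs over F as well and can be compared with the Fourier sum
   term by term. *)
pose b' z := if z \in F0 then b z else 0.
have tE : trig_sum b' F = trig_sum b F0.
  apply/funext => x; rewrite /trig_sum.
  transitivity (\sum_(z <- F | z \in F0) b z * e z x).
    rewrite [RHS]big_mkcond; apply: eq_bigr => z _.
    by rewrite /b'; case: ifP => // _; rewrite mul0r.
  rewrite -big_filter; apply: perm_big; apply: uniq_perm => //.
    exact: filter_uniq.
  by move=> z; rewrite mem_filter; case: (boolP (z \in F0)) => // /F0F ->.
move: fb; rewrite -tE !rnormL2E; try by apply: L2B => //; exact: trig_sum_L2.
rewrite !lte_fin !rnormL2_sub//; apply: le_lt_trans.
rewrite lerD2l ler_wpM2l ?(ltW c0)//.
under eq_bigr do rewrite subrr sqnormc0.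
by rewrite big1// sumr_ge0// => z _; exact: sqnormc_ge0.
Qed.

End fourier.

End complex_measurable.

(** * Density of algebras of bounded functions in L^2 *)

Section threshold_polynomials.
Context (R : realType).
Implicit Types (x r : R).

Lemma bernoulli_ge1D x (n : nat) : -1 <= x -> 1 + n%:R * x <= (1 + x) ^+ n.
Proof.
move=> x1; elim: n => [|n IH]; first by rewrite mul0r addr0 expr0.
rewrite exprS -[n.+1]add1n natrD.
have n0 : (0 <= n%:R :> R) by [].
have : 0 <= n%:R * x ^+ 2 by rewrite mulr_ge0// sqr_ge0.
have : (1 + x) * (1 + n%:R * x) <= (1 + x) * (1 + x) ^+ n by rewrite ler_wpM2l//; lra.
rewrite expr2; lra.
Qed.

(** With s the square root of r, the term is s^n times n s^n. The second factor is bounded, by the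
    Bernoulli inequality for 1/s = 1 + delta, and the first tends to 0. *)
Lemma cvg_natM_expr r : 0 <= r < 1 -> (fun n => n%:R * r ^+ n) @ \oo --> (0 : R).
Proof.
move=> /andP[]; rewrite le_eqVlt => /predU1P[<- _|r0 r1].
  apply: cvg_near_cst; near=> n.
  by rewrite expr0n; case: eqP => [->|_]; rewrite ?mul0r ?mulr0.
pose s := Num.sqrt r.
have s0 : 0 < s by rewrite sqrtr_gt0.
have s1 : s < 1 by rewrite -sqrtr1 ltr_sqrt.
pose delta := s^-1 - 1.
have d0 : 0 < delta by rewrite subr_gt0 invf_gt1.
have ns n : n%:R * s ^+ n <= delta^-1.
  have sn0 : 0 < s ^+ n by rewrite exprn_gt0.
  have : 1 + n%:R * delta <= (1 + delta) ^+ n.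
    by apply: bernoulli_ge1D; apply: le_trans (ltW d0); rewrite lerN10.
  rewrite /delta addrCA subrr addr0 exprVn -[leRHS]mul1r ler_pdivlMr//.
  rewrite mulrDl mul1r => H.
  rewrite -[leRHS]mul1r ler_pdivlMr// mulrAC; apply: le_trans H.
  by rewrite lerDr ltW.
have rE n : n%:R * r ^+ n = s ^+ n * (n%:R * s ^+ n).
  by rewrite -[r]sqr_sqrtr ?ltW// -exprM mulnC exprM expr2 mulrCA.
have sc : (fun n => s ^+ n * delta^-1) @ \oo --> (0 : R).
  rewrite -(mul0r delta^-1); apply: cvgM; last exact: cvg_cst.
  by apply: cvg_expr; rewrite ger0_norm// ltW.
apply: (squeeze_cvgr _ _ sc); last exact: cvg_cst.
near=> n; rewrite rE mulr_ge0/= ?mulr_ge0 ?exprn_ge0 ?(ltW s0)//.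
by rewrite ler_wpM2l// exprn_ge0// ltW.
Unshelve. all: by end_near. Qed.

(* The exponent n 2^n makes the limit at the threshold 1/2 equal to 0. *)
Definition step_poly (n : nat) x : R := (1 - x ^+ n) ^+ (n * 2 ^ n).

Lemma step_poly_itv n x : 0 <= x <= 1 -> 0 <= step_poly n x <= 1.
Proof.
move=> /andP[x0 x1].
have : 0 <= x ^+ n <= 1 by rewrite exprn_ge0//= exprn_ile1.
move=> /andP[a0 a1]; rewrite /step_poly exprn_ge0/= ?exprn_ile1//; lra.
Qed.

(** Bernoulli is used twice, with a = x^n and m = n 2^n. For x < 1/2 the value is at least 1 - m a =
    1 - n (2x)^n. For x >= 1/2 it is at most 1/(1 + a)^m <= 1/(1 + m a) <= 1/(n + 1), because 2^n a
    >= 1. *)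
Lemma cvg_step_poly x : 0 <= x <= 1 ->
  (fun n => step_poly n x) @ \oo --> (((x < 2^-1)%R)%:R : R).
Proof.
move=> x01; have /andP[x0 x1] := x01.
have xn n : 0 <= x ^+ n <= 1 by rewrite exprn_ge0//= exprn_ile1.
case: ltP => x2.
  have c0 : (fun n => 1 - n%:R * (2 * x) ^+ n) @ \oo --> (1 : R).
    rewrite -[X in _ --> X]subr0; apply: cvgB; first exact: cvg_cst.
    by apply: cvg_natM_expr; apply/andP; split; lra.
  apply: (squeeze_cvgr _ c0); last exact: cvg_cst.
  near=> n; have /andP[_ ->] := step_poly_itv n x01; rewrite andbT.
  have /andP[a0 a1] := xn n.
  have : -1 <= - x ^+ n by lra.
  move=> /(bernoulli_ge1D (n * 2 ^ n)); apply: le_trans.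
  by rewrite mulrN natrM natrX exprMn mulrA.
have c0 : (fun n => (n.+1%:R : R)^-1) @ \oo --> (0 : R) by exact: cvg_harmonic.
apply: (squeeze_cvgr _ _ c0); last exact: cvg_cst.
near=> n; have /andP[-> _] := step_poly_itv n x01; rewrite /=.
have /andP[a0 a1] := xn n; set a := x ^+ n in a0 a1 *.
rewrite -[leRHS]mul1r ler_pdivlMr ?ltr0n//.
have B : n.+1%:R <= (1 + a) ^+ (n * 2 ^ n).
  apply: le_trans (bernoulli_ge1D _ _); last by lra.
  rewrite -[n.+1]add1n natrD lerD2l natrM -mulrA ler_peMr//.
  have x2' : 1 <= 2 * x by rewrite mulrC -ler_pdivrMr// mul1r.
  by rewrite natrX -exprMn -[leLHS](expr1n _ n) lerXn2r ?nnegrE// mulr_ge0.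
apply: (@le_trans _ _ ((1 - a) ^+ (n * 2 ^ n) * (1 + a) ^+ (n * 2 ^ n))).
  by rewrite ler_wpM2l// exprn_ge0// subr_ge0.
rewrite -exprMn; have -> : (1 - a) * (1 + a) = 1 - a ^+ 2 by rewrite expr2; ring.
by rewrite exprn_ile1// ?subr_ge0 ?exprn_ile1// lerBlDr lerDl sqr_ge0.
Unshelve. all: by end_near. Qed.

End threshold_polynomials.

(** * The L^2-closure of an algebra of bounded functions *)

Section density.
Import HBNNSimple.
Context d (T : measurableType d) (R : realType).
Variables (mu : {measure set T -> \bar R}) (D : set T).
Hypothesis mD : measurable D.
Hypothesis fD : (mu D < +oo)%E.
Implicit Types (f g p q : T -> R[i]) (h k : T -> R) (E F : set T).
Variable trig : (T -> R[i]) -> Prop.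
Hypothesis trigD : forall p q, trig p -> trig q -> trig (fun x => p x + q x).
Hypothesis trigM : forall p q, trig p -> trig q -> trig (fun x => p x * q x).
Hypothesis trig_cst : forall c : R[i], trig (fun=> c).
Hypothesis trig_meas : forall p, trig p -> cmeas D p.
Hypothesis trig_bdd : forall p, trig p ->
  exists M : R, forall x, D x -> sqnormc (p x) <= M.

Local Notation N2 := (normL2 mu D).
Local Notation cmeas := (cmeas D).

Definition approx f := cmeas f /\
  forall eps : R, 0 < eps -> exists2 p, trig p &
    (N2 (fun x => (f x - p x)%R) < eps%:E)%E.

Let lt_quarters (a b : \bar R) (eps : R) :
  (a < (eps / 4)%:E -> b < (eps / 4)%:E -> 2%:E * a + 2%:E * b < eps%:E)%E.
Proof.
move=> ae be; have -> : eps%:E = (2%:E * (eps / 4)%:E + 2%:E * (eps / 4)%:E)%E.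
  by rewrite -!EFinM -EFinD; congr EFin; lra.
by rewrite lteD// lte_pmul2l.
Qed.

Lemma trig_approx p : trig p -> approx p.
Proof.
move=> tp; split=> [|eps e0]; first exact: trig_meas.
exists p => //; rewrite /normL2 integral0_eq ?lte_fin// => x _.
by rewrite subrr sqnormc0.
Qed.

Lemma approx_closed f : cmeas f ->
  (forall eps : R, 0 < eps -> exists2 g, approx g &
    (N2 (fun x => (f x - g x)%R) < eps%:E)%E) -> approx f.
Proof.
move=> mf fg; split=> // eps e0.
have e4 : 0 < eps / 4 by rewrite divr_gt0.
have [g [mg ag] gf] := fg _ e4; have [p tp pg] := ag _ e4; exists p => //.
have -> : (fun x => f x - p x) = (fun x => (f x - g x) + (g x - p x)).
  by apply/funext => x; rewrite addrA subrK.
apply: le_lt_trans (normL2D_le mu mD _ _) _.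
- exact: cmeasB.
- by apply: cmeasB => //; exact: trig_meas.
exact: lt_quarters.
Qed.

Lemma approxD f g : approx f -> approx g -> approx (fun x => f x + g x).
Proof.
move=> [mf af] [mg ag]; split=> [|eps e0]; first exact: cmeasD.
have e4 : 0 < eps / 4 by rewrite divr_gt0.
have [p tp pf] := af _ e4; have [q tq qg] := ag _ e4.
exists (fun x => p x + q x); first exact: trigD.
have -> : (fun x => f x + g x - (p x + q x)) =
   (fun x => (f x - p x) + (g x - q x)).
  by apply/funext => x; rewrite opprD addrACA.
apply: le_lt_trans (normL2D_le mu mD _ _) _;
  try by apply: cmeasB => //; exact: trig_meas.
exact: lt_quarters.
Qed.

(** The factors are replaced one after the other: the bound on f allows g to be replaced by some q
    in the algebra, and then the bound on q allows f to be replaced. *)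
Lemma approxM f g (M : R) : approx f -> approx g ->
  (forall x, D x -> sqnormc (f x) <= M) -> approx (fun x => f x * g x).
Proof.
move=> [mf af] [mg ag] fM; apply: approx_closed; first exact: cmeasM.
move=> eps e0; pose K := Num.max 1 M.
have K0 : 0 < K by rewrite lt_max ltr01.
have eK : 0 < eps / K / 2 by rewrite !divr_gt0.
have [q tq qg] := ag _ eK.
exists (fun x => f x * q x); last first.
  apply: (@le_lt_trans _ _ (K%:E * N2 (fun x => (g x - q x)%R))%E).
    apply: normL2_le => //; rewrite ?ltW//.
    - by apply: cmeasB; apply: cmeasM => //; exact: trig_meas.
    - by apply: cmeasB => //; exact: trig_meas.
    - move=> x Dx; rewrite -mulrBr sqnormcM ler_wpM2r ?sqnormc_ge0//.
      by rewrite le_max fM ?orbT.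
  apply: lt_le_trans (_ : K%:E * (eps / K / 2)%:E <= _)%E.
    by rewrite lte_pmul2l.
  rewrite -EFinM lee_fin.
  have -> : K * (eps / K / 2) = eps / 2 by field; rewrite gt_eqF.
  lra.
split=> [|eps' e'0]; first by apply: cmeasM => //; exact: trig_meas.
have [M' qM'] := trig_bdd tq; pose K' := Num.max 1 M'.
have K'0 : 0 < K' by rewrite lt_max ltr01.
have eK' : 0 < eps' / K' by rewrite divr_gt0.
have [p tp pf] := af _ eK'.
exists (fun x => p x * q x); first exact: trigM.
apply: (@le_lt_trans _ _ (K'%:E * N2 (fun x => (f x - p x)%R))%E).
  apply: normL2_le => //; rewrite ?ltW//.
  - by apply: cmeasB; apply: cmeasM => //; exact: trig_meas.
  - by apply: cmeasB => //; exact: trig_meas.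
  - move=> x Dx; rewrite -mulrBl sqnormcM mulrC ler_wpM2r ?sqnormc_ge0//.
    by rewrite le_max qM' ?orbT.
have -> : eps' = K' * (eps' / K') by rewrite mulrCA mulfV ?mulr1// gt_eqF.
by rewrite EFinM lte_pmul2l.
Qed.

Lemma approx_scale (c : R[i]) f : approx f -> approx (fun x => c * f x).
Proof.
move=> af; apply: (@approxM _ _ (sqnormc c)) => //.
by apply: trig_approx; exact: trig_cst.
Qed.

(** Boundedness is part of the definition so that the class is closed under products. *)
Definition rapprox h := (exists M : R, forall x, D x -> `|h x| <= M) /\
  approx (fun x => (h x)%:C%C).

Lemma sqnormc_real (r : R) : sqnormc r%:C%C = r ^+ 2.
Proof. by rewrite sqnormcE /= expr0n addr0. Qed.

Lemma rapprox_ext h k : (forall x, D x -> h x = k x) -> rapprox h -> rapprox k.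
Proof.
move=> hk [[M hM] [mh ah]]; split.
  by exists M => x Dx; rewrite -hk// hM.
split.
  have [m1 m2] := mh; split; last exact: measurable_cst.
  by apply: eq_measurable_fun m1 => x /[!inE] Dx /=; exact: hk.
move=> eps /ah[p tp hp]; exists p => //.
by rewrite /normL2 (eq_integral (fun x => (sqnormc ((h x)%:C%C - p x))%:E))//
   => x /[!inE] Dx; rewrite hk.
Qed.

Lemma rapprox_cst (r : R) : rapprox (fun=> r).
Proof.
split; first by exists `|r|.
by apply: trig_approx; exact: trig_cst.
Qed.

Lemma rapproxD h k : rapprox h -> rapprox k -> rapprox (fun x => h x + k x).
Proof.
move=> [[M hM] ah] [[M' kM'] ak]; split.
  by exists (M + M') => x Dx; rewrite (le_trans (ler_normD _ _))// lerD ?hM ?kM'.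
by under eq_fun do rewrite rmorphD; exact: approxD.
Qed.

Lemma rapproxM h k : rapprox h -> rapprox k -> rapprox (fun x => h x * k x).
Proof.
move=> [[M hM] ah] [[M' kM'] ak]; split.
  by exists (M * M') => x Dx; rewrite normrM ler_pM ?hM ?kM'.
under eq_fun do rewrite rmorphM.
apply: (@approxM _ _ (M ^+ 2)) => // x Dx.
by rewrite sqnormc_real -real_normK ?num_real// lerXn2r ?nnegrE ?hM//
  (le_trans _ (hM x Dx)).
Qed.

Lemma rapproxX h n : rapprox h -> rapprox (fun x => h x ^+ n).
Proof.
move=> ah; elim: n => [|n IH].
  by under eq_fun do rewrite expr0; exact: rapprox_cst.
by under eq_fun do rewrite exprS; exact: rapproxM.
Qed.

Lemma rapprox_meas h : rapprox h -> measurable_fun D h.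
Proof. by case=> _ [[]]. Qed.

Let cvg_sqrB (u : nat -> R) (a : R) : u @ \oo --> a ->
  (fun n => ((a - u n) ^+ 2)%:E) @ \oo --> 0%E.
Proof.
move=> ua; apply: cvg_EFin; first by near=> n.
rewrite [X in X @ _ --> _](_ : _ = (fun n => (a - u n) * (a - u n))) //.
rewrite -(mulr0 (a - a)) -[X in _ * X](subrr a).
by apply: cvgM; apply: cvgB => //; exact: cvg_cst.
Unshelve. all: by end_near. Qed.

(** Dominated convergence: the squared differences are at most (2M)^2, a constant that is integrable
    over D. *)
Lemma rapprox_lim (h_ : nat -> T -> R) h (M : R) :
  (forall n, rapprox (h_ n)) ->
  (forall n x, D x -> `|h_ n x| <= M) ->
  (forall x, D x -> (fun n => h_ n x) @ \oo --> h x) -> rapprox h.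
Proof.
move=> ah hM hh.
have mh : measurable_fun D h.
  by apply: (measurable_fun_cvg _ hh) => n; apply: rapprox_meas.
have hM' x : D x -> `|h x| <= M.
  move=> Dx; have := hh x Dx; move/cvg_norm => hx.
  have /cvg_lim <- // := hx.
  apply: limr_le; first by apply/cvg_ex; exists `|h x|.
  by near=> n; exact: hM.
split; first by exists M.
apply: approx_closed; first exact: cmeas_real.
move=> eps e0.
pose f_ n x : \bar R := (sqnormc ((h x)%:C%C - (h_ n x)%:C%C))%:E.
have mf n : measurable_fun D (f_ n).
  by apply: measurable_sqnormc; apply: cmeasB; apply: cmeas_real => //; exact: rapprox_meas.
have fE n x : f_ n x = ((h x - h_ n x) ^+ 2)%:E.
  by rewrite /f_ -rmorphB sqnormc_real.
have f0 x : D x -> (fun n => f_ n x) @ \oo --> 0%E.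
  move=> Dx; under eq_fun do rewrite fE.
  exact/cvg_sqrB/hh.
have ig : mu.-integrable D (cst ((2 * M) ^+ 2)%:E) by exact: integrable_const.
have fg n x : D x -> (`|f_ n x| <= (cst ((2 * M) ^+ 2)%:E : T -> \bar R) x)%E.
  move=> Dx; rewrite fE /= lee_fin ger0_norm ?sqr_ge0//.
  have M0 : 0 <= M by apply: le_trans (hM' _ Dx).
  rewrite -real_normK ?num_real// lerXn2r ?nnegrE ?mulr_ge0//.
  rewrite (le_trans (ler_normB _ _))// mulr_natl mulr2n.
  by rewrite lerD ?hM' ?hM.
have [_ _] := dominated_convergence mD mf (measurable_cst 0%E)
   (aeW mu f0) ig (aeW mu (fun x n => @fg n x)).
rewrite integral0 => cv.
have : \forall n \near \oo, (\int[mu]_(x in D) f_ n x < eps%:E)%E.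
  by apply: (cv _ (open_ereal_lt' _)); rewrite lte_fin.
move=> [N _ /(_ N (leqnn N))] fN; exists (fun x => (h_ N x)%:C%C) => //.
by case: (ah N).
Unshelve. all: by end_near. Qed.

Definition good E := rapprox (\1_E : T -> R).

Lemma goodC E : good E -> good (~` E).
Proof.
move=> gE; have := rapproxD (rapprox_cst 1) (rapproxM (rapprox_cst (- 1)) gE).
apply: rapprox_ext => x _; rewrite !indicE in_setC.
by case: (x \in E); rewrite ?mulr1 ?subrr ?mulr0 ?addr0.
Qed.

Lemma good0 : good set0.
Proof.
by apply: rapprox_ext (rapprox_cst 0) => x _; rewrite indicE in_set0.
Qed.

Lemma goodI E F : good E -> good F -> good (E `&` F).
Proof.
move=> gE gF; apply: rapprox_ext (rapproxM gE gF) => x _.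
by rewrite !indicE in_setI; case: (x \in E); case: (x \in F);
  rewrite ?mulr1 ?mulr0 ?mul0r.
Qed.

Lemma goodU E F : good E -> good F -> good (E `|` F).
Proof.
move=> gE gF; rewrite -[X in good X]setCK setCU.
by apply: goodC; apply: goodI; exact: goodC.
Qed.

Lemma good_bigcup (E : nat -> set T) :
  (forall n, good (E n)) -> good (\bigcup_n E n).
Proof.
move=> gE; pose U n := \big[setU/set0]_(i < n) E i.
have gU n : good (U n).
  by rewrite /U; elim/big_ind : _ => //; [exact: good0|exact: goodU].
apply: (@rapprox_lim (fun n => \1_(U n)) _ 1) => //.
- by move=> n x _; rewrite indicE normr_nat lern1 leq_b1.
move=> x _; have [[m _ Em]|nE] := pselect ((\bigcup_n E n) x).
  rewrite indicE mem_set; last by exists m.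
  apply: cvg_near_cst; exists m.+1 => // n /= mn.
  rewrite indicE mem_set// /U -bigcup_mkord; exists m => //.
rewrite indicE memNset//; apply: cvg_near_cst; near=> n.
rewrite indicE memNset// /U -bigcup_mkord => -[m _ Em].
by apply: nE; exists m.
Unshelve. all: by end_near. Qed.

Lemma good_sigma_algebra : sigma_algebra setT good.
Proof.
split; first exact: good0.
  by move=> E gE; rewrite setTD; exact: goodC.
exact: good_bigcup.
Qed.

(** The function k = 1/2 - s h takes values in [0, 1] for this s, and k < 1/2 exactly where h > 0.
    The step polynomials of k therefore converge boundedly to the indicator. *)
Lemma good_pos h : rapprox h -> good [set x | 0 < h x].
Proof.
move=> ah; have [[M hM] _] := ah.
pose s := (2 * (1 + `|M|))^-1.
have M1 : 0 < 2 * (1 + `|M|) by rewrite mulr_gt0// ltr_pwDl.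
have s0 : 0 < s by rewrite invr_gt0.
pose k x := 2^-1 + (- s) * h x.
have ak : rapprox k.
  by apply: rapproxD; [exact: rapprox_cst|apply: rapproxM => //; exact: rapprox_cst].
have k01 x : D x -> 0 <= k x <= 1.
  move=> Dx; have : `|s * h x| <= 2^-1.
    rewrite normrM gtr0_norm// /s ler_pdivrMl//.
    apply: le_trans (hM x Dx) _; rewrite mulrAC mulfV ?mul1r//.
    by rewrite (le_trans (ler_norm _))// lerDr.
  by rewrite ler_norml /k mulNr => /andP[? ?]; apply/andP; split; lra.
apply: (@rapprox_lim (fun n x => step_poly n (k x)) _ 1).
- move=> n; rewrite /step_poly.
  apply: rapprox_ext (rapproxX (n * 2 ^ n) (rapproxD (rapprox_cst 1)
    (rapproxM (rapprox_cst (-1)) (rapproxX n ak)))) => x _.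
  by rewrite mulN1r.
- move=> n x /k01 /(step_poly_itv n) /andP[q0 q1].
  by rewrite ger0_norm.
- move=> x Dx; rewrite indicE.
  have -> : (x \in [set x | 0 < h x]) = (k x < 2^-1).
    by apply/idP/idP; rewrite inE /= /k gtrDl mulNr oppr_lt0 pmulr_rgt0.
  by apply: cvg_step_poly; exact: k01.
Qed.

Hypothesis all_good : forall E, measurable E -> good E.

Lemma rapprox_sum (I : Type) (s : seq I) (F : I -> T -> R) :
  (forall i, rapprox (F i)) -> rapprox (fun x => \sum_(i <- s) F i x).
Proof.
move=> aF; elim: s => [|i s IH].
  by under eq_fun do rewrite big_nil; exact: rapprox_cst.
by under eq_fun do rewrite big_cons; exact: rapproxD.
Qed.

Lemma rapprox_nnsfun (h : {nnsfun T >-> R}) : rapprox h.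
Proof.
have -> : (h : T -> R) = fun x => \sum_(y <- fset_set (range h)) y * \1_(h @^-1` [set y]) x.
  by apply/funext => x; rewrite [LHS]fimfunE fsbig_finite.
apply: rapprox_sum => y; apply: rapproxM; first exact: rapprox_cst.
exact: all_good.
Qed.

(** Simple functions increase to h, and the squared differences are dominated by h^2. *)
Lemma approx_ge0 h : measurable_fun D h -> (forall x, D x -> 0 <= h x) ->
  (N2 (fun x => (h x)%:C%C) < +oo)%E -> approx (fun x => (h x)%:C%C).
Proof.
move=> mh h0 h2; apply: approx_closed; first exact: cmeas_real.
move=> eps e0.
have meh : measurable_fun D (EFin \o h) by exact/measurable_EFinP.
pose h_ := nnsfun_approx mD meh.
have h_cvg x : D x -> (fun n => h_ n x) @ \oo --> h x.
  move=> Dx; have h0' y : D y -> (0 <= (EFin \o h) y)%E by exact: h0.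
  exact: (fine_cvg (cvg_nnsfun_approx mD meh h0' Dx)).
have h_le n x : D x -> h_ n x <= h x.
  move=> /h_cvg hx; have /cvg_lim <- // := hx.
  apply: (@nondecreasing_cvgn_le _ (fun n => h_ n x)).
    by move=> m p mp; have /lefP := nd_nnsfun_approx mD meh mp.
  by apply/cvg_ex; exists (h x).
pose f_ n x : \bar R := (sqnormc ((h x)%:C%C - (h_ n x)%:C%C))%:E.
have mf n : measurable_fun D (f_ n).
  apply: measurable_sqnormc; apply: cmeasB; apply: cmeas_real => //.
  by apply: rapprox_meas; exact: rapprox_nnsfun.
have fE n x : f_ n x = ((h x - h_ n x) ^+ 2)%:E.
  by rewrite /f_ -rmorphB sqnormc_real.
have f0 x : D x -> (fun n => f_ n x) @ \oo --> 0%E.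
  move=> Dx; under eq_fun do rewrite fE.
  exact/cvg_sqrB/h_cvg.
have ig : mu.-integrable D (EFin \o (fun x => sqnormc (h x)%:C%C)).
  by apply: sqnormc_integrable => //; split => //; exact: cmeas_real.
have fg n x : D x -> (`|f_ n x| <= (EFin \o (fun x => sqnormc (h x)%:C%C)) x)%E.
  move=> Dx; rewrite fE /= lee_fin ger0_norm ?sqr_ge0// sqnormc_real.
  rewrite lerXn2r ?nnegrE ?subr_ge0 ?h_le ?h0// gerBl.
  by rewrite fun_ge0.
have [_ _] := dominated_convergence mD mf (measurable_cst 0%E)
   (aeW mu f0) ig (aeW mu (fun x n => @fg n x)).
rewrite integral0 => cv.
have : \forall n \near \oo, (\int[mu]_(x in D) f_ n x < eps%:E)%E.
  by apply: (cv _ (open_ereal_lt' _)); rewrite lte_fin.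
move=> [N _ /(_ N (leqnn N))] fN; exists (fun x => (h_ N x)%:C%C) => //.
by case: (rapprox_nnsfun (h_ N)).
Qed.

Lemma L2_approx f : L2 mu D f -> approx f.
Proof.
have real_part h : measurable_fun D h -> (N2 (fun x => (h x)%:C%C) < +oo)%E ->
    approx (fun x => (h x)%:C%C).
  move=> mh h2.
  have part (u : T -> R) : measurable_fun D u -> (forall x, 0 <= u x <= `|h x|) ->
      approx (fun x => (u x)%:C%C).
    move=> mu' u01; apply: approx_ge0 => //.
      by move=> x _; have /andP[] := u01 x.
    apply: le_lt_trans h2; rewrite -[leRHS]mul1e; apply: normL2_le => //.
    move=> x Dx; rewrite mul1r !sqnormc_real; have /andP[u0 uh] := u01 x.
    by rewrite -(real_normK (num_real (h x))) lerXn2r.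
  have -> : (fun x => (h x)%:C%C) =
      (fun x => (h^\+ x)%:C%C + (-1) * (h^\- x)%:C%C).
    apply/funext => x; rewrite mulN1r -rmorphB; congr (_%:C)%C.
    by rewrite -[LHS]/(h x) -{1}(funrposBneg h).
  apply: approxD; last apply: approx_scale; apply: part.
  - exact: measurable_funrpos.
  - move=> x; rewrite /funrpos le_max lexx orbT/= ge_max ler_norm normr_ge0//.
  - exact: measurable_funrneg.
  - move=> x; rewrite /funrneg le_max lexx orbT/= ge_max normr_ge0 andbT.
    by rewrite -normrN ler_norm.
move=> [mf f2]; have [m1 m2] := mf.
have -> : f = (fun x => (complex.Re (f x))%:C%C + 'i%C * (complex.Im (f x))%:C%C).
  by apply/funext => x; rewrite -complexE.
apply: approxD; last apply: approx_scale; apply: real_part => //.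
- apply: le_lt_trans f2; rewrite -[leRHS]mul1e; apply: normL2_le => //.
  by move=> x _; rewrite mul1r sqnormc_real sqnormcE lerDl sqr_ge0.
- apply: le_lt_trans f2; rewrite -[leRHS]mul1e; apply: normL2_le => //.
  by move=> x _; rewrite mul1r sqnormc_real sqnormcE lerDr sqr_ge0.
Qed.

End density.

(** * Fourier series on the cell *)

Section cell_fourier.
Context (R : realType) (d : nat) (A : 'M[R]_d).
Hypothesis uA : A \in unitmx.
Implicit Types (x y u : 'cV[R]_d) (z m s : 'cV[int]_d).
Let T := lebesgue_space R d.
Let mu : {measure set T -> \bar R} := leb R d.
Let D : set T := cell A.
Let mD : measurable D := measurable_cell A.
Let fD : (mu D < +oo)%E := cell_finite uA.

Definition dlat z : 'cV[R]_d := (invmx A)^T *m map_mx intr z.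
Definition ez z (x : T) : R[i] := expo (dlat z) x.

Lemma dlatD z m : dlat (z + m) = dlat z + dlat m.
Proof. by rewrite /dlat map_mxD mulmxDr. Qed.

Lemma dlatN z : dlat (- z) = - dlat z.
Proof. by rewrite /dlat map_mxN mulmxN. Qed.

Lemma dlat_inj : injective dlat.
Proof.
move=> z m /(congr1 (mulmx A^T)); rewrite /dlat !mulmxA -trmx_mul mulVmx//.
rewrite trmx1 !mul1mx => /matrixP E.
by apply/matrixP => i j; have := E i j; rewrite !mxE => /eqP; rewrite eqr_int => /eqP.
Qed.

Lemma dot_dlat z x : dot (dlat z) x = dot (map_mx intr z) (crd A x).
Proof. by rewrite /dlat dotC dot_mulmxr trmxK dotC. Qed.

Lemma ezD z m x : ez (z + m) x = ez z x * ez m x.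
Proof. by rewrite /ez dlatD expoDl. Qed.

Lemma ez0 x : ez 0 x = 1.
Proof. by rewrite /ez /dlat map_mx0 mulmx0 expo0l. Qed.

Lemma ez_conj z x : (ez z x)^*%C = ez (- z) x.
Proof. by rewrite /ez expo_conj dlatN. Qed.

Lemma sqnormc_ez z x : sqnormc (ez z x) = 1.
Proof. exact: sqnormc_expo. Qed.

Lemma dot_int z m : exists k : int,
  dot (map_mx intr z) (map_mx intr m : 'cV[R]_d) = k%:~R.
Proof.
exists (\sum_i z i 0 * m i 0); rewrite /dot rmorph_sum /=.
by apply: eq_bigr => i _; rewrite !mxE rmorphM.
Qed.

Lemma ez_periodic z m x : ez z (x - lat A m) = ez z x.
Proof.
rewrite /ez -latN expoDr.
have -> : expo (dlat z) (lat A (- m)) = 1; last by rewrite mulr1.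
rewrite expoE dot_dlat crd_lat//; have [k ->] := dot_int z (- m).
exact: cis_int.
Qed.

Lemma cmeas_expo (E : set T) t : cmeas E (expo t : T -> R[i]).
Proof.
have mt : measurable_fun E (fun x : T => 2 * pi * dot t x).
  apply: measurable_funM; first exact: measurable_cst.
  apply: measurable_sum => i; apply: measurable_funM; first exact: measurable_cst.
  exact: measurable_coord.
split; apply: measurableT_comp mt; apply: continuous_measurable_fun.
- exact: continuous_cos.
- exact: continuous_sin.
Qed.

(** Translation invariance is available for nonnegative functions, so it is applied to 1 + g, whose
    translate is 1 - g. *)
Let Rintegral_antiperiodic (g : T -> R) u : measurable_fun setT g ->
  (forall x, `|g x| <= 1) -> (forall x z, g (x - lat A z) = g x) ->
  (forall x, g (x - u) = - g x) -> (\int[mu]_(x in D) g x)%R = 0.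
Proof.
move=> mg g1 gp gu.
have := @integral_cell_periodic R d A uA (fun x => (1 + g x)%:E) u.
have mf : measurable_fun setT (fun x : T => (1 + g x)%:E).
  apply/measurable_EFinP; apply: measurable_funD => //; exact: measurable_cst.
move=> /(_ mf); have f0 x : (0 <= (1 + g x)%:E)%E.
  by rewrite lee_fin; have := g1 x; rewrite ler_norml => /andP[]; lra.
move=> /(_ f0); have fp x z : (1 + g (x - lat A z))%:E = (1 + g x)%:E by rewrite gp.
move=> /(_ fp) H.
have g2 : L2 mu D (fun x => (g x)%:C%C).
  apply: (L2_bounded mD fD (M := 1)).
    by apply: cmeas_real; exact: measurable_funTS.
  by move=> x _; rewrite sqnormc_real -real_normK ?num_real// exprn_ile1.
have [ig _] := L2_integrable mD fD g2.
have i1 : mu.-integrable D (EFin \o (fun=> 1 : R)) by exact: integrable_const.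
have : (\int[mu]_(x in D) (1 - g x) = \int[mu]_(x in D) (1 + g x))%R.
  rewrite /Rintegral; congr fine; rewrite -H.
  by apply: eq_integral => x _; rewrite gu.
rewrite RintegralB// RintegralD// => /eqP.
rewrite -subr_eq0 opprD addrACA subrr add0r -opprD oppr_eq0 -mulr2n.
by rewrite mulrn_eq0/= => /eqP.
Qed.

(* Translating by u changes the sign of ez (z - m), so its mean is zero. *)
Lemma ez_orth z m : z != m -> cint mu D (fun x => ez z x * (ez m x)^*%C) = 0.
Proof.
move=> zm.
have -> : (fun x => ez z x * (ez m x)^*%C) = ez (z - m).
  by apply/funext => x; rewrite ez_conj ezD.
set s := z - m; pose t := dlat s.
have t0 : dot t t != 0.
  apply/eqP => tt; case/eqP: zm; apply/eqP; rewrite -subr_eq0; apply/eqP.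
  have tz : t = 0.
    apply/colP => i; rewrite [RHS]mxE; move/eqP: tt; rewrite psumr_eq0; last first.
      by move=> j _; rewrite -expr2 sqr_ge0.
    move=> /allP/(_ i); rewrite mem_index_enum => /(_ isT).
    by rewrite -expr2 sqrf_eq0 => /eqP.
  by apply: dlat_inj; rewrite -/s -/t tz /dlat map_mx0 mulmx0.
(* Chosen so that t . u = 1/2; the translation then multiplies the exponential by e^(-i pi). *)
pose u := (2 * dot t t)^-1 *: t.
have eu x : ez s (x - u) = - ez s x.
  rewrite /ez expoDr -/t [expo t (- u)]expoE dotNr dotZr.
  have -> : 2 * pi * - ((2 * dot t t)^-1 * dot t t) = - pi :> R.
    by field; rewrite t0.
  have -> : cis (- pi) = -1 :> R[i].
    rewrite /cis cosN sinN cospi sinpi; apply/eqP.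
    by rewrite eq_complex /= oppr0 !eqxx.
  by rewrite mulrN1.
have [m1 m2] := cmeas_expo setT t.
have le1 x : `|complex.Re (ez s x)| <= 1 /\ `|complex.Im (ez s x)| <= 1.
  have := sqnormc_ez s x; rewrite sqnormcE => E.
  split; rewrite -(@expr_le1 _ 2)// real_normK ?num_real// -E.
    by rewrite lerDl sqr_ge0.
  by rewrite lerDr sqr_ge0.
have ReE : (\int[mu]_(x in D) complex.Re (ez s x))%R = 0.
  apply: (@Rintegral_antiperiodic (fun x => complex.Re (ez s x)) u m1) => x.
  - exact: (le1 x).1.
  - by move=> n; rewrite ez_periodic.
  - by rewrite eu; case: (ez s x).
have ImE : (\int[mu]_(x in D) complex.Im (ez s x))%R = 0.
  apply: (@Rintegral_antiperiodic (fun x => complex.Im (ez s x)) u m2) => x.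
  - exact: (le1 x).2.
  - by move=> n; rewrite ez_periodic.
  - by rewrite eu; case: (ez s x).
by rewrite /cint ReE ImE.
Qed.

(** Frequencies may repeat in the list, which makes sums and products immediate; [cell_fourier]
    collects repeated ones. *)
Definition trigpoly (p : T -> R[i]) := exists r : seq (R[i] * 'cV[int]_d),
  p = fun x => \sum_(q <- r) q.1 * ez q.2 x.

Lemma trigpoly_ez z : trigpoly (ez z).
Proof.
by exists [:: (1, z)]; apply/funext => x; rewrite big_seq1 mul1r.
Qed.

Lemma trigpolyD p q : trigpoly p -> trigpoly q -> trigpoly (fun x => p x + q x).
Proof.
move=> [r ->] [r' ->]; exists (r ++ r'); apply/funext => x.
by rewrite big_cat.
Qed.

Lemma trigpolyM p q : trigpoly p -> trigpoly q -> trigpoly (fun x => p x * q x).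
Proof.
move=> [r ->] [r' ->].
exists [seq (a.1 * b.1, a.2 + b.2) | a <- r, b <- r']; apply/funext => x.
rewrite big_allpairs_dep/= mulr_suml; apply: eq_bigr => a _.
by rewrite mulr_sumr; apply: eq_bigr => b _; rewrite ezD mulrACA.
Qed.

Lemma trigpoly_cst c : trigpoly (fun=> c).
Proof.
by exists [:: (c, 0)]; apply/funext => x; rewrite big_seq1 ez0 mulr1.
Qed.

Lemma trigpoly_meas p : trigpoly p -> cmeas D p.
Proof.
move=> [r ->]; apply: cmeas_sum => q.
by apply: cmeasM; [exact: cmeas_cst|exact: cmeas_expo].
Qed.

Lemma trigpoly_bdd p : trigpoly p ->
  exists M : R, forall x, D x -> sqnormc (p x) <= M.
Proof.
move=> [r ->]; exists ((size r)%:R * \sum_(q <- r) sqnormc q.1) => x _.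
apply: le_trans (sqnormc_sum_le _ _) _.
by under eq_bigr do rewrite sqnormcM sqnormc_ez mulr1.
Qed.

Notation rapprox := (rapprox mu D trigpoly).
Notation good := (good mu D trigpoly).

Let rcst (r : R) : rapprox (fun=> r).
Proof. exact: (rapprox_cst mu trigpoly_cst trigpoly_meas r). Qed.

Let rD (h k : T -> R) : rapprox h -> rapprox k -> rapprox (fun x => h x + k x).
Proof. exact: (rapproxD mD trigpolyD trigpoly_meas). Qed.

Let rM (h k : T -> R) : rapprox h -> rapprox k -> rapprox (fun x => h x * k x).
Proof. exact: (rapproxM mD trigpolyM trigpoly_meas trigpoly_bdd). Qed.

Let gpos (h : T -> R) : rapprox h -> good [set x | 0 < h x].
Proof.
exact: (good_pos mD fD trigpolyD trigpolyM trigpoly_cst trigpoly_meas trigpoly_bdd).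
Qed.

Let gI (E F : set T) : good E -> good F -> good (E `&` F).
Proof. exact: (goodI mD trigpolyM trigpoly_meas trigpoly_bdd). Qed.

Let gU (E F : set T) : good E -> good F -> good (E `|` F).
Proof.
exact: (goodU mD trigpolyD trigpolyM trigpoly_cst trigpoly_meas trigpoly_bdd).
Qed.

Let gsigma : sigma_algebra [set: T] good.
Proof.
exact: (good_sigma_algebra mD fD trigpolyD trigpolyM trigpoly_cst trigpoly_meas
  trigpoly_bdd).
Qed.

Let gext (E F : set T) : (forall x, D x -> (E x <-> F x)) -> good E -> good F.
Proof.
move=> EF; apply: rapprox_ext => x Dx; rewrite !indicE.
suff -> : (x \in E) = (x \in F) by [].
by apply/idP/idP; rewrite !inE => /(EF x Dx).
Qed.

Let trig_rapprox (h : T -> R) : (forall x, `|h x| <= 1) ->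
  trigpoly (fun x => (h x)%:C%C) -> rapprox h.
Proof.
by move=> h1 th; split; [exists 1|apply: (trig_approx mu trigpoly_meas)].
Qed.

Lemma ez_delta i x : ez (delta_mx i 0) x = cis (2 * pi * crd A x i 0).
Proof.
rewrite /ez expoE dot_dlat; congr (cis (_ * _)).
have dE j : (map_mx intr (delta_mx i 0 : 'cV[int]_d) : 'cV[R]_d) j 0 = (j == i)%:R.
  by rewrite !mxE eqxx andbT; case: (j == i).
rewrite /dot (bigD1 i)//= dE eqxx mul1r big1 ?addr0// => j ji.
by rewrite dE (negPf ji) mul0r.
Qed.

Lemma rapprox_cos i : rapprox (fun x => cos (2 * pi * crd A x i 0)).
Proof.
apply: trig_rapprox => [x|]; first exact: cos_max.
have := trigpolyD (trigpolyM (trigpoly_cst 2^-1) (trigpoly_ez (delta_mx i 0)))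
  (trigpolyM (trigpoly_cst 2^-1) (trigpoly_ez (- delta_mx i 0))).
congr trigpoly; apply/funext => x; rewrite -ez_conj ez_delta /cis.
rewrite -mulrDr; set c := cos _; set s := sin _.
have -> : ((c +i* s)%C + ((c +i* s)^*)%C) = 2 * c%:C%C :> R[i].
  by rewrite mulr_natl mulr2n; apply/eqP; rewrite eq_complex /= subrr addr0 !eqxx.
by rewrite mulKf.
Qed.

Lemma rapprox_sin i : rapprox (fun x => sin (2 * pi * crd A x i 0)).
Proof.
apply: trig_rapprox => [x|]; first exact: sin_max.
have := trigpolyD (trigpolyM (trigpoly_cst (2 * 'i%C)^-1) (trigpoly_ez (delta_mx i 0)))
  (trigpolyM (trigpoly_cst (- (2 * 'i%C)^-1)) (trigpoly_ez (- delta_mx i 0))).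
congr trigpoly; apply/funext => x; rewrite -ez_conj ez_delta /cis.
rewrite mulNr -mulrBr; set c := cos _; set s := sin _.
have -> : ((c +i* s)%C - ((c +i* s)^*)%C) = 2 * 'i%C * s%:C%C :> R[i].
  rewrite -mulrA mulr_natl mulr2n; apply/eqP; rewrite eq_complex /=.
  by apply/andP; split; apply/eqP; ring.
rewrite mulKf// mulf_neq0 ?pnatr_eq0//.
by rewrite eq_complex /= oner_eq0 andbF.
Qed.

(* On [0, 1[ the value of y can be read off from the signs of sin (2 pi y) and
   of cos (2 pi y) - cos (2 pi t), since cos is decreasing on [0, pi]. *)
Let coord_ltP (t y : R) : 0 <= y < 1 -> 0 <= t < 1 ->
  (t < y) <-> if t <= 2^-1
    then sin (2 * pi * y) < 0 \/ cos (2 * pi * y) < cos (2 * pi * t)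
    else sin (2 * pi * y) < 0 /\ cos (2 * pi * t) < cos (2 * pi * y).
Proof.
have pi0 := pi_gt0 R.
have cosC (w : R) : cos (2 * pi * (1 - w)) = cos (2 * pi * w).
  have -> : 2 * pi * (1 - w) = - (2 * pi * w) + pi *+ 2 by rewrite mulr2n; ring.
  by rewrite cosD2pi cosN.
have sinC (w : R) : sin (2 * pi * (1 - w)) = - sin (2 * pi * w).
  have -> : 2 * pi * (1 - w) = - (2 * pi * w) + pi *+ 2 by rewrite mulr2n; ring.
  by rewrite sinD2pi sinN.
have cos_lt (v w : R) : 0 <= v <= 2^-1 -> 0 <= w <= 2^-1 ->
    (cos (2 * pi * v) < cos (2 * pi * w)) = (w < v).
  move=> /andP[v0 v1] /andP[w0 w1].
  rewrite (@ltr_cos R) ?in_itv/=; last 2 first.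
  - by apply/andP; split; nra.
  - by apply/andP; split; nra.
  by rewrite ltr_pM2l// mulr_gt0.
have sin_lt (w : R) : 0 <= w < 1 -> (sin (2 * pi * w) < 0) = (2^-1 < w).
  move=> /andP[w0 w1]; case: (ltP 2^-1 w) => w2.
    rewrite -[w](subKr 1) sinC oppr_lt0; apply: sin_gt0_pi.
    by apply/andP; split; nra.
  by apply/negbTE; rewrite -leNgt; apply: sin_ge0_pi; apply/andP; split; nra.
move=> y01 /andP[t0 t1]; rewrite sin_lt//; move: y01 => /andP[y0 y1].
case: ifPn => [t2|]; last rewrite -ltNge => t2.
  have [y2|y2] := ltP 2^-1 y.
    by split=> [_|_]; [left|exact: le_lt_trans y2].
  by rewrite cos_lt ?t0 ?y0//; split=> [|[]//]; right.
split=> [ty|[y2]].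
  have y2 := lt_trans t2 ty; split => //.
  by rewrite -(cosC t) -(cosC y) cos_lt; [|apply/andP; split; lra..]; lra.
by rewrite -(cosC t) -(cosC y) cos_lt; [|apply/andP; split; lra..]; lra.
Qed.

(** On the cell the set is everything for t < 0 and empty for t >= 1. In between, [coord_ltP] makes
    it a union or an intersection of two positivity sets. *)
Let good_crd_gt i (t : R) : good [set x | t < crd A x i 0].
Proof.
have [t0|t0] := ltP t 0.
  apply: gext (gpos (rcst 1)) => x /(_ i)/andP[x0 x1] /=.
  by rewrite ltr01 (lt_le_trans t0 x0).
have [t1|t1] := ltP t 1; last first.
  apply: gext (gpos (rcst 0)) => x /(_ i)/andP[x0 x1] /=.
  by rewrite ltxx; split=> // tc; have := lt_trans (le_lt_trans t1 tc) x1; rewrite ltxx.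
have sneg : good [set x | 0 < 0 + (-1) * sin (2 * pi * crd A x i 0)].
  exact: (gpos (rD (rcst _) (rM (rcst _) (rapprox_sin i)))).
have t01 : 0 <= t < 1 by rewrite t0.
have [t2|t2] := leP t 2^-1.
  have clt : good [set x | 0 < cos (2 * pi * t) + (-1) * cos (2 * pi * crd A x i 0)].
    exact: (gpos (rD (rcst _) (rM (rcst _) (rapprox_cos i)))).
  apply: gext (gU sneg clt) => x /(_ i) y01 /=.
  rewrite (coord_ltP y01 t01) t2 add0r !mulN1r oppr_gt0 subr_gt0.
  by split.
have clt : good [set x | 0 < cos (2 * pi * crd A x i 0) + - cos (2 * pi * t)].
  exact: (gpos (rD (rapprox_cos i) (rcst _))).
apply: gext (gI sneg clt) => x /(_ i) y01 /=.
rewrite (coord_ltP y01 t01) leNgt t2/= add0r !mulN1r oppr_gt0 subr_gt0.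
by split.
Qed.

(** The same space with the good sets as measurable sets, so that goodness of boxes becomes
    measurability of the coordinates. *)
Let S := g_sigma_algebraType good.

Let measurable_good (E : set S) : measurable E -> good E.
Proof. by apply: smallest_sub. Qed.

Let good_measurable_crd i : measurable_fun setT (fun x : S => crd A (x : 'cV[R]_d) i 0).
Proof.
apply: (measurability _ (RGenOInfty.measurableE R)) => //.
move=> _ [_ [c ->] <-]; rewrite setTI; apply: sub_sigma_algebra.
rewrite (_ : _ @^-1` _ = [set x | c < crd A x i 0]); first exact: good_crd_gt.
by apply/seteqP; split=> x /=; rewrite in_itv/= andbT.
Qed.

Let good_measurable_coord i : measurable_fun setT (fun x : S => (x : 'cV[R]_d) i 0).
Proof.
rewrite (_ : (fun x : S => _) =
  (fun x : S => \sum_j A i j * crd A (x : 'cV[R]_d) j 0)); last first.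
  apply/funext => x; transitivity ((A *m crd A (x : 'cV[R]_d)) i 0).
    by rewrite /crd mulKVmx.
  by rewrite mxE.
apply: measurable_sum => j; apply: measurable_funM; first exact: measurable_cst.
exact: good_measurable_crd.
Qed.

Let good_measurable_box a b : measurable (box a b : set S).
Proof.
rewrite (_ : box a b = \bigcap_(i in [set: 'I_d])
   ((fun x : S => (x : 'cV[R]_d) i 0) @^-1` `]a i 0, b i 0]%classic)).
  apply: fin_bigcap_measurable => [|i _]; first exact: finite_finset.
  rewrite -[X in measurable X]setTI.
  exact: (good_measurable_coord i measurableT (measurable_itv `]a i 0, b i 0])).
apply/seteqP; split=> x.
  by move=> cx i _ /=; rewrite in_itv; exact: cx.
by move=> cx i; have := cx i Logic.I; rewrite /= in_itv.
Qed.

Let good_boxes (c : set nat * (nat -> 'cV[R]_d * 'cV[R]_d)) :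
  good (\bigcup_(n in c.1) box (c.2 n).1 (c.2 n).2).
Proof.
apply: measurable_good; apply: bigcup_measurable => n _.
exact: good_measurable_box.
Qed.

(** A union U of boxes covers E [&] D with excess measure at most eps / 2. On D, the squared
    difference of the indicators of E and U is the indicator of that excess. *)
Lemma measurable_is_good (E : set T) : measurable E -> good E.
Proof.
move=> mE; split.
  by exists 1 => x _; rewrite indicE normr_nat lern1 leq_b1.
apply: (approx_closed mD trigpoly_meas).
  by apply: cmeas_real; exact: measurable_indic.
move=> eps e0.
have mED : measurable (E `&` D) by exact: measurableI.
have fED : (mu (E `&` D) < +oo)%E.
  by apply: le_lt_trans fD; apply: le_measure; rewrite ?inE//; exact: subIsetr.
have e2 : 0 < eps / 2 by rewrite divr_gt0.
have [c [EDU Ule]] := @leb_approx R d (E `&` D) (eps / 2) fED e2.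
set U := \bigcup_(n in c.1) _ in EDU Ule.
have mU : measurable (U : set T).
  by apply: bigcup_measurable => n _; exact: box_measurable.
exists (fun x => (\1_U x)%:C%C); first by case: (good_boxes c).
rewrite /normL2 (_ : (\int[mu]_(x in D) _)%E =
    (\int[mu]_(x in D) (\1_(U `\` (E `&` D)) x)%:E)%E); last first.
  apply: eq_integral => x /[!inE] Dx; congr EFin.
  rewrite -rmorphB sqnormc_real !indicE in_setD in_setI (mem_set Dx) andbT.
  have [xE|xE] := boolP (x \in E); last first.
    by rewrite sub0r sqrrN andbT; case: (x \in U); rewrite ?expr1n ?expr0n.
  rewrite mem_set ?subrr ?expr0n//; apply: EDU; split=> //.
  by move: xE; rewrite inE.
rewrite integral_indic//; last exact: measurableD.
apply: (@le_lt_trans _ _ (mu (U `\` (E `&` D)))).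
  apply: le_measure; rewrite ?inE; last exact: subIsetl.
    by apply: measurableI => //; exact: measurableD.
  exact: measurableD.
rewrite measureD//; last first.
  by apply: le_lt_trans Ule _; rewrite lte_add_pinfty// ltry.
have -> : U `&` (E `&` D) = E `&` D by apply/setIidPr.
rewrite lteBlDr ?ge0_fin_numE//; apply: le_lt_trans Ule _.
rewrite addeC lteD2rE ?ge0_fin_numE// lte_fin; lra.
Qed.

Theorem cell_fourier (f : T -> R[i]) : L2 mu D f ->
  forall eps : R, 0 < eps -> exists2 F0, uniq F0 &
    forall F, uniq F -> {subset F0 <= F} ->
    (normL2 mu D (fun x : T => (f x - trig_sum ez (coef mu D ez f) F x)%R) < eps%:E)%E.
Proof.
move=> f2.
have me z : cmeas D (ez z) by exact: cmeas_expo.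
have c0 : 0 < fine (mu D) by rewrite fine_gt0// fD andbT; exact: cell_gt0.
apply: (fourier_converges mD fD me sqnormc_ez c0 ez_orth _ f2).
move=> eps e0.
have [_ /(_ eps e0)[_ [r ->] fr]] := L2_approx mD trigpolyD trigpolyM trigpoly_cst
  trigpoly_meas trigpoly_bdd measurable_is_good f2.
(* Coefficients of equal frequencies are added up, since [trig_sum] is used with a duplicate-free
   list. *)
exists (fun z => \sum_(q <- r | q.2 == z) q.1), (undup [seq q.2 | q <- r]).
split; first exact: undup_uniq.
congr (_ < _)%E: fr; congr normL2; apply/funext => x; congr (_ - _).
rewrite /trig_sum; under [RHS]eq_bigr do rewrite mulr_suml.
rewrite (exchange_big_dep predT)//= big_seq [RHS]big_seq; apply: eq_bigr => q qr.
rewrite -big_filter (_ : [seq z <- _ | _] = [:: q.2]).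
  by rewrite big_seq1.
rewrite -[RHS](@filter_pred1_uniq _ (undup [seq q.2 | q <- r])) ?undup_uniq//.
  by apply: eq_filter => z; rewrite /= eq_sym.
by rewrite mem_undup; exact: map_f.
Qed.

End cell_fourier.

(** * Generic frequencies and Vandermonde inverses *)

Section generic_frequency.
Context (R : realType).

Lemma finite_root_set (p : {poly R}) : p != 0 -> finite_set [set x | root p x].
Proof.
move=> p0; apply: contrapT => /(infinite_set_fset (size p))[B BA sB].
suff : (size B < size p)%N by rewrite ltnNge sB.
apply: max_poly_roots => //; last exact: fset_uniq.
by apply/allP => x xB; exact: BA.
Qed.

(** There are countably many nonzero integer polynomials, each with finitely many real roots, so the
    roots form a null set, whereas [0, 1] has measure 1. *)
Lemma exists_transcendental :
  exists t : R, forall p : {poly int}, (map_poly intr p).[t] = 0 -> p = 0.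
Proof.
pose Z := \bigcup_(p in [set p : {poly int} | p != 0])
  [set x : R | root (map_poly intr p) x].
have cZ : countable Z.
  apply: bigcup_countable => [|p p0]; first exact: countableP.
  apply: finite_set_countable.
  by apply: finite_root_set; rewrite map_poly_eq0_id0 // intr_eq0 lead_coef_eq0.
have [t tZ] : exists t, ~ Z t.
  apply: contrapT => /forallNP H.
  have : Z = setT by apply/seteqP; split=> x // _; exact: contrapT.
  move=> ZT; have := countable_lebesgue_measure0 cZ; rewrite ZT.
  move=> T0; have : (lebesgue_measure (`[0%R, 1%R]%classic : set R) <= 0)%E.
    by rewrite -T0; apply: le_outer_measure.
  by rewrite lebesgue_measure_itv/= lte_fin ltr01 oppr0 adde0 lee_fin ler10.
exists t => p pt; apply/eqP/negPn/negP => p0.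
by apply: tZ; exists p => //=; apply/rootP.
Qed.

(* For w = (t, ..., t^d) with t transcendental, an integral relation between 1
   and the entries of w is a polynomial equation for t. *)
Lemma lattice_character_inj (d : nat) (A : 'M[R]_d) : A \in unitmx ->
  exists v : 'cV[R]_d, forall l1 l2, lattice_of A l1 -> lattice_of A l2 ->
    expo v l1 = expo v l2 -> l1 = l2.
Proof.
move=> uA; have [t tP] := exists_transcendental.
pose w : 'cV[R]_d := \col_i t ^+ i.+1.
(* The pairing of this vector with A z is w . z. *)
exists ((invmx A)^T *m w) => _ _ [z1 _ <-] [z2 _ <-] E.
suff : z1 - z2 = 0 by move/eqP; rewrite subr_eq0 => /eqP ->.
set z := z1 - z2.
have : expo ((invmx A)^T *m w) (A *m map_mx intr z) = 1.
  rewrite /z map_mxB mulmxBr expoDr E -expoDr subrr expoC; exact: expo0l.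
rewrite expoE dotC dot_mulmxr trmxK mulKmx// dotC => /cis_eq1[m Em].
(* Exponents start at 1, so that m occupies the constant coefficient and the entries of z are the
   others. *)
pose p : {poly int} := \sum_(i < d) z i 0 *: 'X^(i.+1) - m%:P.
have p0 : p = 0.
  apply: tP; rewrite /p rmorphB rmorph_sum /= map_polyC hornerD hornerN hornerC.
  rewrite horner_sum; apply/eqP; rewrite subr_eq0; apply/eqP.
  etransitivity; last exact: Em.
  apply: eq_bigr => i _.
  by rewrite linearZ /= map_polyXn hornerZ hornerXn !mxE mulrC.
apply/colP => i; rewrite [RHS]mxE.
have := congr1 (fun q : {poly int} => q`_i.+1) p0.
rewrite coef0 coefB coefC subr0 coef_sum (bigD1 i)//= coefZ coefXn eqxx mulr1.
rewrite big1 ?addr0// => j ji; rewrite coefZ coefXn eqSS.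
by rewrite (_ : (i == j :> nat) = false) ?mulr0//; apply/negbTE; rewrite eq_sym.
Qed.

End generic_frequency.

(** B is the inverse of the Vandermonde matrix V with nodes w i, i in S. Its columns are indexed by
    all of 'I_n, with zeros outside S, which spares an enumeration of S later. The two conditions
    are V B = 1 and B V = 1. *)
Lemma vandermonde_inverse (K : fieldType) (n : nat) (w : 'I_n -> K)
    (S : {set 'I_n}) : injective w ->
  exists B : 'I_#|S| -> 'I_n -> K,
    (forall i i', i \in S -> \sum_(j < #|S|) w i ^+ j * B j i' = (i == i')%:R) /\
    (forall j j' : 'I_#|S|, \sum_(i in S) B j i * w i ^+ j' = (j == j')%:R).
Proof.
move=> w_inj.
pose V : 'M[K]_#|S| := (Vandermonde #|S| (\row_m w (enum_val m)))^T.
have uV : V \in unitmx.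
  rewrite unitmx_tr unitmxE det_Vandermonde unitfE.
  apply/prodf_neq0 => a _; apply/prodf_neq0 => b ab.
  rewrite !mxE subr_eq0; apply: contraTneq ab => /w_inj/enum_val_inj ->.
  by rewrite ltnn.
have VE a j : V a j = w (enum_val a) ^+ j by rewrite !mxE.
exists (fun j i => \sum_m (enum_val m == i)%:R * invmx V j m); split.
  move=> i i' iS; rewrite -(enum_rankK_in iS iS); set a := enum_rank_in iS i.
  under eq_bigr do rewrite mulr_sumr.
  rewrite exchange_big /= (bigD1 a)//= [X in _ + X]big1 ?addr0.
    under eq_bigr do rewrite mulrCA -VE.
    have /matrixP/(_ a a) := mulmxV uV; rewrite !mxE eqxx => aa.
    by rewrite -mulr_sumr aa mulr1.
  move=> m ma; under eq_bigr do rewrite mulrCA -VE.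
  have /matrixP/(_ a m) := mulmxV uV; rewrite !mxE eq_sym (negPf ma) => am.
  by rewrite -mulr_sumr am mulr0.
move=> j j'.
under eq_bigr do rewrite mulr_suml.
rewrite exchange_big /=.
have /matrixP/(_ j j') := mulVmx uV; rewrite !mxE => <-.
apply: eq_bigr => m _; rewrite (bigD1 (enum_val m)) ?enum_valP//= eqxx mul1r VE.
rewrite big1 ?addr0// => i /andP[_ im].
by rewrite eq_sym (negPf im) !mul0r.
Qed.

(** * Riesz bases of exponentials *)

Section riesz_basis_of_finite.
Context (R : realType) (d : nat) (Omega : set 'cV[R]_d).
Context (I : choiceType) (t : I -> 'cV[R]_d).
Let T := lebesgue_space R d.
Let mu : {measure set T -> \bar R} := leb R d.
Let Om : set T := Omega.
Hypothesis mO : measurable Om.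

Let S (b : I -> R[i]) (F : {fset I}) (x : T) : R[i] :=
  \sum_(i <- F) b i * expo (t i) x.

Let meas_S b F : cmeas Om (S b F).
Proof.
apply: cmeas_sum => i; apply: cmeasM; first exact: cmeas_cst.
exact: cmeas_expo.
Qed.

Let N := normL2 mu Om.

Variables c1 c2 : R.
Hypotheses (c1_gt0 : 0 < c1) (c2_gt0 : 0 < c2).
Hypothesis finite_lower : forall b (F : {fset I}),
  ((c1 * \sum_(i <- F) sqnormc (b i))%:E <= N (S b F))%E.
Hypothesis finite_upper : forall b (F : {fset I}),
  (N (S b F) <= (c2 * \sum_(i <- F) sqnormc (b i))%:E)%E.
Hypothesis expansion : forall f : T -> R[i], L2 mu Om f ->
  exists a : I -> R[i], expands_as Omega t f a.

(** For F containing i and both threshold sets, the two partial sums are close to f, hence to each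
    other, and [finite_lower] bounds |b i - a i|^2 by their distance. *)
Let expands_unique f a b : cmeas Om f ->
  expands_as Omega t f a -> expands_as Omega t f b -> b = a.
Proof.
move=> mf fa fb; apply/funext => i; apply/eqP; rewrite -subr_eq0; apply/eqP.
apply: sqnormc_eq0; apply/eqP; rewrite eq_le sqnormc_ge0 andbT.
apply/ler_addgt0Pl => e e0; rewrite addr0.
have e4 : 0 < c1 * e / 4 by rewrite divr_gt0// mulr_gt0.
have [F1 aF1] := fa _ e4; have [F2 bF2] := fb _ e4.
pose F := ([fset i] `|` (F1 `|` F2))%fset.
have aF : (N (fun x => (f x - S a F x)%R) < (c1 * e / 4)%:E)%E.
  by apply: aF1; rewrite /F fsetUCA fsubsetUl.
have bF : (N (fun x => (f x - S b F x)%R) < (c1 * e / 4)%:E)%E.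
  by apply: bF2; rewrite /F fsetUA fsubsetUr.
rewrite -(ler_pM2l c1_gt0) -lee_fin.
apply: (@le_trans _ _ (N (S (fun i => b i - a i) F))).
  apply: le_trans (finite_lower _ _); rewrite lee_fin ler_wpM2l ?(ltW c1_gt0)//.
  rewrite (big_fsetD1 i) /= ?lerDl; last by rewrite /F !inE eqxx.
  by apply: sumr_ge0 => j _; exact: sqnormc_ge0.
have -> : S (fun i => b i - a i) F =
    fun x => (f x - S a F x) - (f x - S b F x).
  apply/funext => x; rewrite opprB addrC addrA subrK /S -sumrB.
  by apply: eq_bigr => j _; rewrite mulrBl.
apply: le_trans (normL2B_le mu mO (cmeasB mf (meas_S _ _)) (cmeasB mf (meas_S _ _))) _.
apply: (@le_trans _ _ (2%:E * (c1 * e / 4)%:E + 2%:E * (c1 * e / 4)%:E)%E).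
  by apply: leeD; rewrite lee_pmul2l// ltW.
by rewrite -!EFinM -EFinD lee_fin; lra.
Qed.

(** Each finite sum of |a i|^2 is at most 1/c1 times the squared norm of a partial sum close to f.
    The factor 2 comes from writing that sum as f minus the error. *)
Let upper_bound f a : cmeas Om f -> expands_as Omega t f a ->
  (\esum_(i in [set: I]) (sqnormc (a i))%:E <= (2 / c1)%:E * N f)%E.
Proof.
move=> mf fa; apply: ge_ereal_sup => _ [X [fX _] <-].
rewrite fsbig_finite//=; set F := fset_set X.
apply/lee_addgt0Pr => e e0.
have e2 : 0 < c1 * e / 2 by rewrite divr_gt0// mulr_gt0.
have [F0 aF0] := fa _ e2; pose F' := (F0 `|` F)%fset.
have aF' : (N (fun x => (f x - S a F' x)%R) < (c1 * e / 2)%:E)%E.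
  by apply: aF0; exact: fsubsetUl.
have c1i : 0 <= c1^-1 by rewrite invr_ge0 ltW.
apply: (@le_trans _ _ ((c1^-1)%:E * N (S a F'))%E).
  apply: (@le_trans _ _ ((c1^-1)%:E * (c1 * \sum_(i <- F') sqnormc (a i))%:E)%E).
    rewrite -EFinM mulrA mulVf ?gt_eqF// mul1r sumEFin lee_fin.
    rewrite [leRHS](big_fsetID _ (mem F)) /= [X in X + _](_ : _ = \sum_(i <- F) sqnormc (a i)).
      by rewrite lerDl; apply: sumr_ge0 => j _; exact: sqnormc_ge0.
    congr (\sum_(i <- enum_fset _) _); apply/fsetP => i; rewrite !inE /=.
    by case: (i \in F); rewrite ?orbT ?andbF.
  by rewrite lee_wpmul2l// finite_lower.
have -> : S a F' = fun x => f x - (f x - S a F' x).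
  by apply/funext => x; rewrite subKr.
apply: (@le_trans _ _ ((c1^-1)%:E * (2%:E * N f + 2%:E * (c1 * e / 2)%:E))%E).
  rewrite lee_wpmul2l//.
  apply: le_trans (normL2B_le mu mO mf (cmeasB mf (meas_S _ _))) _.
  by rewrite leeD2l// lee_pmul2l// ltW.
rewrite ge0_muleDr ?mule_ge0 ?normL2_ge0 ?lee_fin ?(ltW e2)//.
rewrite (_ : (2 / c1)%:E * N f = (c1^-1)%:E * (2%:E * N f))%E; last first.
  by rewrite muleA -EFinM mulrC.
rewrite leeD2l// -!EFinM lee_fin.
by have -> : c1^-1 * (2 * (c1 * e / 2)) = e by field; rewrite gt_eqF.
Qed.

Let lower_bound f a : cmeas Om f -> expands_as Omega t f a ->
  ((2 * c2)^-1%:E * N f <= \esum_(i in [set: I]) (sqnormc (a i))%:E)%E.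
Proof.
move=> mf fa.
have c20 : 0 < 2 * c2 by rewrite mulr_gt0.
rewrite -(@lee_pmul2l _ (2 * c2)%:E)// muleA -EFinM mulfV ?gt_eqF// mul1e.
apply/lee_addgt0Pr => e e0.
have e2 : 0 < e / 2 by rewrite divr_gt0.
have [F aF] := fa _ e2.
have -> : f = fun x => S a F x + (f x - S a F x).
  by apply/funext => x; rewrite addrC subrK.
apply: le_trans (normL2D_le mu mO (meas_S _ _) (cmeasB mf (meas_S _ _))) _.
apply: leeD; last first.
  apply: (@le_trans _ _ (2%:E * (e / 2)%:E)%E).
    by rewrite lee_pmul2l// ltW// aF.
  by rewrite -EFinM lee_fin; lra.
rewrite EFinM -muleA lee_pmul2l//; apply: le_trans (finite_upper _ _) _.
rewrite EFinM lee_pmul2l// ?lte_fin//.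
apply: esum_ge; exists [set` F]; first by split => //; exact: finite_fset.
by rewrite fsbig_finite ?set_fsetK//= sumEFin.
Qed.

Lemma riesz_basis_of_finite : exp_riesz_basis Omega t.
Proof.
exists (2 * c2)^-1, (2 / c1); split.
- by rewrite invr_gt0 mulr_gt0.
- by rewrite divr_gt0.
move=> f [f1 f2 f3]; have [a fa] := expansion (conj (conj f1 f2) f3).
have mf : cmeas Om f by [].
exists a; split => //; first by move=> b; exact: expands_unique.
by rewrite lower_bound//= upper_bound.
Qed.

End riesz_basis_of_finite.

(** * Multiple lattice tiles *)

Section multitile.
Context (R : realType) (d k : nat) (A : 'M[R]_d) (v : 'cV[R]_d).
Hypothesis uA : A \in unitmx.
Hypothesis v_inj : forall l1 l2, lattice_of A l1 -> lattice_of A l2 ->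
  expo v l1 = expo v l2 -> l1 = l2.
Let T := lebesgue_space R d.
Let mu : {measure set T -> \bar R} := leb R d.
Let D : set T := cell A.
Let mD : measurable D := measurable_cell A.
Let fD : (mu D < +oo)%E := cell_finite uA.
Context (Omega : set 'cV[R]_d).
Let Om : set T := Omega.
Hypothesis mO : measurable Om.
Hypothesis tO : tiles_at_level k (lattice_of A) Omega.
Variable s : seq 'cV[int]_d.
Hypothesis us : uniq s.
Hypothesis sO : forall x, Omega x -> - zfl A x \in s.

Let n := size s.
Let la (i : 'I_n) : 'cV[R]_d := lat A (tnth (in_tuple s) i).
(** The fibre over x, recorded by positions in s: a subset of a finite type, so that it takes
    finitely many values. *)
Let Sx (x : T) : {set 'I_n} := finset (fun i => (x - la i) \in Omega).

Let la_inj : injective la.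
Proof. by move=> i j /(lat_inj uA); apply/tuple_uniqP. Qed.

Let sum_Sx (F : T -> \bar R) x :
  (\sum_(m <- s) (F \_ Om) (x - lat A m)%R = \sum_(i in Sx x) F (x - la i)%R)%E.
Proof.
rewrite big_tnth [RHS]big_mkcond; apply: eq_bigr => i _.
by rewrite patchE inE.
Qed.

Let measurable_sum_Sx (F : T -> \bar R) : measurable_fun Om F ->
  measurable_fun D (fun x => (\sum_(i in Sx x) F (x - la i)%R)%E).
Proof.
move=> mF; under eq_fun do rewrite -sum_Sx.
apply: emeasurable_sum => m; apply: measurable_fun_translate.
exact/(measurable_restrictT _ mO).
Qed.

Let integral_Om (F : T -> \bar R) : measurable_fun Om F ->
  (forall x, (0 <= F x)%E) ->
  (\int[mu]_(x in Om) F x = \int[mu]_(x in D) \sum_(i in Sx x) F (x - la i)%R)%E.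
Proof.
move=> mF F0; rewrite integral_mkcond (ge0_integral_unfold uA _ _ us); first last.
- move=> x xs; rewrite patchE ifF//; apply/negbTE; rewrite notin_setE => Ex.
  by move: xs; rewrite sO.
- by move=> x; rewrite patchE; case: ifP.
- exact/(measurable_restrictT _ mO).
by apply: eq_integral => x _; exact: sum_Sx.
Qed.

(** For x in the cell, x - lat z in Omega forces z to be in s, so the tiling sum is a finite
    count. *)
Let card_Sx x : D x ->
  (\esum_(l in lattice_of A) (\1_Omega (x - l) : R)%:E = (#|Sx x|%:R)%:E)%E.
Proof.
move=> Dx.
rewrite (reindex_esum [set: 'cV[int]_d] _ (lat A)); last first.
  split=> [z _|z1 z2 _ _ |_ [z _ <-]]; [by exists z|exact: lat_inj|by exists z].
have zs z : z \notin s -> \1_Omega (x - lat A z) = 0 :> R.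
  move=> zs; rewrite indicE memNset// => /sO; rewrite zfl_subl//.
  by move/(cellP A): Dx => ->; rewrite add0r opprK (negPf zs).
transitivity (\esum_(z in [set` s]) (\1_Omega (x - lat A z) : R)%:E)%E.
  rewrite [RHS]esum_mkcond; apply: eq_esum => z _.
  by case: ifPn => //; rewrite mem_setE => /zs ->.
rewrite esum_fset; [|exact: finite_seq|by move=> z _; rewrite lee_fin].
rewrite -fsbig_seq// sumEFin; congr EFin.
rewrite big_tnth -sum1_card natr_sum [RHS]big_mkcond; apply: eq_bigr => i _.
by rewrite indicE inE; case: ifP.
Qed.

Let ae_card : {ae mu, forall x, D x -> #|Sx x| = k}.
Proof.
have : {ae mu, forall x : T, (\esum_(l in lattice_of A)
  (\1_Omega ((x : 'cV[R]_d) - l) : R)%:E)%E = k%:R%:E} by exact: tO.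
apply: filterS => x xk Dx.
by move: xk; rewrite card_Sx// => -[] /eqP; rewrite eqr_nat => /eqP.
Qed.

Let a (j : 'I_k) : 'cV[R]_d := (j : nat)%:R *: v.
Let w (i : 'I_n) : R[i] := expo v (- la i).

Let w_inj : injective w.
Proof.
move=> i i' E; apply: la_inj; apply: oppr_inj; apply: v_inj => //.
  by exists (- tnth (in_tuple s) i) => //; rewrite -[LHS]/(lat A _) latN.
by exists (- tnth (in_tuple s) i') => //; rewrite -[LHS]/(lat A _) latN.
Qed.

Let expo_a j x i : expo (a j) (x - la i) = expo (a j) x * w i ^+ j.
Proof. by rewrite expoDr {2}/a expoZnl. Qed.

(** Over the cell, fibres of a size other than k occur only on a null set; the condition on B is
    void for them, which makes B total in S. *)
Let B_ex (S : {set 'I_n}) : exists B : 'I_k -> 'I_n -> R[i], #|S| = k ->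
  (forall i i', i \in S -> \sum_(j < k) w i ^+ j * B j i' = (i == i')%:R) /\
  (forall j j' : 'I_k, \sum_(i in S) B j i * w i ^+ j' = (j == j')%:R).
Proof.
have [<-|kS] := eqVneq #|S| k.
  by have [B HB] := vandermonde_inverse S w_inj; exists B.
by exists (fun _ _ => 0) => /eqP; rewrite (negPf kS).
Qed.

Let B S := projT1 (cid (B_ex S)).
Let B_spec S := projT2 (cid (B_ex S)).
(** Summing over all subsets S gives one bound for the entries of every matrix, hence a constant
    independent of x. *)
Let M0 : R := \sum_S \sum_j \sum_i sqnormc (B S j i).

Let B_le S j i : sqnormc (B S j i) <= M0.
Proof.
have nn (X : finType) (P : pred X) (F : X -> R[i]) : 0 <= \sum_(y | P y) sqnormc (F y).
  by apply: sumr_ge0 => y _; exact: sqnormc_ge0.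
rewrite /M0 (bigD1 S)//= (bigD1 j)//= (bigD1 i)//= -!addrA lerDl.
rewrite addr_ge0 ?nn// addr_ge0//; first by apply: sumr_ge0.
by apply: sumr_ge0 => S' _; apply: sumr_ge0.
Qed.

Let M0_ge0 : 0 <= M0.
Proof. by do 3 (apply: sumr_ge0 => ? _); exact: sqnormc_ge0. Qed.

Let sqnormc_sum_in (X : finType) (P : {set X}) (F : X -> R[i]) :
  sqnormc (\sum_(i in P) F i) <= #|X|%:R * \sum_(i in P) sqnormc (F i).
Proof.
rewrite -!big_enum /=; apply: le_trans (sqnormc_sum_le _ _) _.
rewrite ler_wpM2r ?ler_nat -?cardE ?max_card//.
by apply: sumr_ge0 => i _; exact: sqnormc_ge0.
Qed.

Let sqnormc_sum_all (F : 'I_k -> R[i]) :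
  sqnormc (\sum_j F j) <= k%:R * \sum_j sqnormc (F j).
Proof.
have := sqnormc_sum_in [set: 'I_k]%SET F; rewrite card_ord.
by rewrite !(eq_bigl _ _ (@finset.in_setT _)).
Qed.

(** * Comparison of norms on Omega and on the cell *)

Section comparison.
Variables (H : T -> R[i]) (G : 'I_k -> T -> R[i]).
Hypothesis mH : cmeas Om H.
Hypothesis mG : forall j, cmeas D (G j).
Hypothesis HG : forall x, D x -> #|Sx x| = k -> forall i, i \in Sx x ->
  H (x - la i) = \sum_j expo (a j) (x - la i) * G j x.

Let F (y : T) : \bar R := (sqnormc (H y))%:E.
Let mF : measurable_fun Om F. Proof. exact: measurable_sqnormc. Qed.
Let F0 y : (0 <= F y)%E. Proof. by rewrite lee_fin sqnormc_ge0. Qed.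
Let mG2 j : measurable_fun D (fun x => (sqnormc (G j x))%:E).
Proof. exact: measurable_sqnormc. Qed.

Let K (x : T) : \bar R := (\sum_j sqnormc (G j x))%:E.
Let K0 x : (0 <= K x)%E.
Proof. by rewrite lee_fin; apply: sumr_ge0 => j _; exact: sqnormc_ge0. Qed.
Let mK : measurable_fun D K.
Proof. by rewrite /K; under eq_fun do rewrite -sumEFin; exact: emeasurable_sum. Qed.

Let P (x : T) : \bar R := (\sum_(i in Sx x) F (x - la i)%R)%E.
Let P0 x : (0 <= P x)%E. Proof. by apply: sume_ge0 => i _; exact: F0. Qed.
Let mP : measurable_fun D P. Proof. exact: measurable_sum_Sx. Qed.

Let sum_normG : (\sum_j normL2 mu D (G j) = \int[mu]_(x in D) K x)%E.
Proof.
rewrite /K; under [RHS]eq_integral do rewrite -sumEFin.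
rewrite (ge0_integral_sum mu mD mG2)// => j x _.
by rewrite lee_fin sqnormc_ge0.
Qed.

(** Cauchy-Schwarz on k unimodular multiples of the G j gives the factor k at each point of a fibre,
    and a fibre has at most n points. *)
Lemma comparison_upper :
  (normL2 mu Om H <= (n%:R * k%:R)%:E * \sum_j normL2 mu D (G j))%E.
Proof.
have nk0 : 0 <= n%:R * k%:R :> R by [].
rewrite sum_normG -(ge0_integralZl_EFin mu mD (fun x _ => K0 x) mK nk0).
rewrite /normL2 (integral_Om mF F0).
have Q0 x : D x -> (0 <= (n%:R * k%:R)%:E * K x)%E.
  by move=> _; apply: mule_ge0; [rewrite lee_fin|exact: K0].
apply: (ae_ge0_le_integral mD (fun x _ => P0 x) mP Q0 (measurable_funeM _ mK)).
apply: filterS ae_card => x + Dx => /(_ Dx) xk.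
rewrite /P /K /F sumEFin -EFinM lee_fin.
apply: (@le_trans _ _ (\sum_(i in Sx x) k%:R * \sum_j sqnormc (G j x))).
  apply: ler_sum => i iS; rewrite HG//; apply: le_trans (sqnormc_sum_all _) _.
  by under eq_bigr do rewrite sqnormcM sqnormc_expo mul1r.
rewrite sumr_const -[leLHS]mulr_natl mulrA ler_wpM2r//.
- by apply: sumr_ge0 => j _; exact: sqnormc_ge0.
- by rewrite ler_wpM2r// ler_nat -[leqRHS]card_ord max_card.
Qed.

(** By B V = 1, expo (a j) x times G j x is the combination of the values of H on the fibre with
    coefficients B (Sx x) j i. Cauchy-Schwarz over n indices and the bound M0 estimate it; summing
    over j gives the factor k. *)
Lemma comparison_lower :
  (\sum_j normL2 mu D (G j) <= (k%:R * n%:R * M0)%:E * normL2 mu Om H)%E.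
Proof.
have C0 : 0 <= k%:R * n%:R * M0 :> R by rewrite !mulr_ge0.
rewrite sum_normG /normL2 (integral_Om mF F0).
rewrite -(ge0_integralZl_EFin mu mD (fun x _ => P0 x) mP C0).
have Q0 x : D x -> (0 <= (k%:R * n%:R * M0)%:E * P x)%E.
  by move=> _; apply: mule_ge0; [rewrite lee_fin|exact: P0].
apply: (ae_ge0_le_integral mD (fun x _ => K0 x) mK Q0 (measurable_funeM _ mP)).
apply: filterS ae_card => x + Dx => /(_ Dx) xk.
rewrite /P /K /F sumEFin -EFinM lee_fin.
set E := \sum_(i in Sx x) _.
apply: (@le_trans _ _ (\sum_(j < k) n%:R * (M0 * E))); last first.
  by rewrite sumr_const card_ord -[leLHS]mulr_natl !mulrA.
apply: ler_sum => j _.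
have [_ BS] := B_spec xk.
have -> : sqnormc (G j x) = sqnormc (\sum_(i in Sx x) B (Sx x) j i * H (x - la i)).
  have -> : \sum_(i in Sx x) B (Sx x) j i * H (x - la i) = expo (a j) x * G j x.
    transitivity (\sum_(j' < k) expo (a j') x * G j' x *
        \sum_(i in Sx x) B (Sx x) j i * w i ^+ j').
      under [RHS]eq_bigr do rewrite mulr_sumr.
      rewrite [RHS]exchange_big /=; apply: eq_bigr => i iS.
      rewrite HG// mulr_sumr; apply: eq_bigr => j' _; rewrite expo_a; ring.
    rewrite (bigD1 j)//= BS eqxx mulr1 big1 ?addr0// => j' jj'.
    by rewrite BS eq_sym (negPf jj') mulr0.
  by rewrite sqnormcM sqnormc_expo mul1r.
apply: le_trans (sqnormc_sum_in _ _) _; rewrite card_ord ler_wpM2l//.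
rewrite mulr_sumr; apply: ler_sum => i _.
by rewrite sqnormcM ler_wpM2r ?sqnormc_ge0// B_le.
Qed.

End comparison.

(** * Interpolation on the fibres *)

Let fO (f : T -> R[i]) (y : T) : R[i] := if y \in Om then f y else 0.

Let cmeas_fO f : cmeas Om f -> cmeas setT (fO f).
Proof.
move=> [m1 m2]; split.
  rewrite (_ : (fun x => _) = (fun x => complex.Re (f x)) \_ Om).
    exact/(measurable_restrictT _ mO).
  by apply/funext => x; rewrite patchE /fO; case: ifP.
rewrite (_ : (fun x => _) = (fun x => complex.Im (f x)) \_ Om).
  exact/(measurable_restrictT _ mO).
by apply/funext => x; rewrite patchE /fO; case: ifP.
Qed.

(* The coefficients at x of the Lagrange interpolation polynomial taking the
   value f (x - la i) at the node w i, for i in Sx x. *)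
Let interp (f : T -> R[i]) (j : 'I_k) (x : T) : R[i] :=
  expo (- a j) x * \sum_i B (Sx x) j i * fO f (x - la i).

(** This is V B = 1; the factor expo (- a j) x in [interp] cancels the part of the exponential
    common to the whole fibre. *)
Let interpP f x : #|Sx x| = k -> forall i, i \in Sx x ->
  f (x - la i) = \sum_j expo (a j) (x - la i) * interp f j x.
Proof.
move=> xk i iS; have [BS _] := B_spec xk.
transitivity (\sum_i' (i == i')%:R * fO f (x - la i')).
  rewrite (bigD1 i)//= eqxx mul1r [X in fO _ _ + X]big1.
    by move: iS; rewrite /Sx finset.in_set addr0 /fO => ->.
  by move=> i' ii'; rewrite eq_sym (negPf ii') mul0r.
under eq_bigr => i' _ do rewrite -(BS i i' iS) mulr_suml.
rewrite exchange_big /=; apply: eq_bigr => j _.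
rewrite /interp expo_a expoNl (mulrC (expo (a j) x)) -[RHS]mulrA.
rewrite mulVKf ?expo_neq0// mulr_sumr; apply: eq_bigr => i' _.
by rewrite mulrA.
Qed.

Let measurable_Sx (S : {set 'I_n}) : measurable ([set x | Sx x = S] : set T).
Proof.
have mi i : measurable ([set x : T | Om (x - la i)] : set T).
  rewrite -[X in measurable X]setTI.
  exact: (measurable_translate (la i) measurableT mO).
rewrite (_ : [set x | Sx x = S] = \bigcap_(i in [set: 'I_n])
   (if i \in S then [set x : T | Om (x - la i)] else ~` [set x : T | Om (x - la i)])).
  apply: fin_bigcap_measurable => [|i _]; first exact: finite_finset.
  by case: ifP => _; [exact: mi|apply: measurableC; exact: mi].
apply/seteqP; split=> x /=.
  move=> <- i _; rewrite /Sx inE; case: ifPn => [|/negP] /=; first by rewrite inE.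
  by rewrite inE.
move=> xS; apply/setP => i; rewrite /Sx inE; have := xS i Logic.I.
case: ifP => _ /= Hi; first by rewrite mem_set.
by rewrite memNset.
Qed.

(** The matrix B (Sx x) is constant on each of the finitely many measurable sets where Sx x = S. *)
Let cmeas_interp f j : cmeas Om f -> cmeas D (interp f j).
Proof.
move=> mf; apply: cmeasM; first exact: cmeas_expo.
rewrite (_ : (fun x => _) = (fun x => \sum_(S : {set 'I_n})
   (\1_([set x | Sx x = S] : set T) x : R)%:C%C *
   \sum_i B S j i * fO f (x - la i))); last first.
  apply/funext => x; rewrite (bigD1 (Sx x))//= indicE mem_set// mul1r.
  rewrite [X in _ = _ + X]big1 ?addr0// => S SS; rewrite indicE memNset ?mul0r//.
  by move=> /= E; rewrite E eqxx in SS.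
apply: cmeas_sum => S; apply: cmeasM.
  by apply: cmeas_real; apply: measurable_indic; exact: measurable_Sx.
apply: cmeas_sum => i; apply: cmeasM; first exact: cmeas_cst.
have [m1 m2] := cmeas_fO mf; split.
  exact: (measurable_fun_translate (G := fun y => complex.Re (fO f y))).
exact: (measurable_fun_translate (G := fun y => complex.Im (fO f y))).
Qed.

(** * Exponential sums over the translated dual lattice *)

Let Ls := lattice_of (invmx A)^T.
Let I := ('I_k * set_type Ls)%type.
Let freq (p : I) : 'cV[R]_d := a p.1 + val p.2.

(** The family is indexed by points of the dual lattice, Fourier series by integer vectors; [lof]
    and [zof] pass between them. *)
Let lof (z : 'cV[int]_d) : set_type Ls :=
  exist _ (dlat A z) (mem_set (ex_intro2 _ _ z Logic.I erefl)).

Let zof_ex (l : set_type Ls) : exists z, lof z = l.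
Proof.
have [z _ zl] : Ls (val l) by exact: set_mem (valP l).
by exists z; apply: val_inj.
Qed.
Let zof l := projT1 (cid (zof_ex l)).
Let zofK l : lof (zof l) = l.
Proof. exact: projT2 (cid (zof_ex l)). Qed.

Let S (b : I -> R[i]) (F : {fset I}) (x : T) : R[i] :=
  \sum_(p <- F) b p * expo (freq p) x.

Let Fj (F : {fset I}) j := [seq zof p.2 | p <- F & p.1 == j].
Let bj (b : I -> R[i]) j z := b (j, lof z).
Let Gj b F j := trig_sum (ez A) (bj b j) (Fj F j).

Let GjE b F j x : Gj b F j x =
  \sum_(p <- F | p.1 == j) b p * expo (val p.2) x.
Proof.
rewrite /Gj /trig_sum big_map big_filter; apply: eq_bigr => -[j' l] /= /eqP <-.
by rewrite /bj zofK; congr (_ * expo _ _); rewrite -[l in RHS]zofK.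
Qed.

Let uniq_Fj F j : uniq (Fj F j).
Proof.
rewrite map_inj_in_uniq ?filter_uniq ?fset_uniq//.
move=> [j1 l1] [j2 l2]; rewrite !mem_filter /= => /andP[/eqP-> _] /andP[/eqP-> _].
by move=> /(congr1 lof); rewrite !zofK => ->.
Qed.

Let Gj_periodic b F j x i : Gj b F j (x - la i) = Gj b F j x.
Proof. by apply: eq_bigr => z _; rewrite ez_periodic. Qed.

Let S_decomp b F x : S b F x = \sum_j expo (a j) x * Gj b F j x.
Proof.
rewrite /S (partition_big (fun p : I => p.1) xpredT)//=.
apply: eq_bigr => j _; rewrite GjE mulr_sumr; apply: eq_bigr => p /eqP pj.
by rewrite /freq expoDl pj mulrCA.
Qed.

Let c := fine (mu D).
Let c0 : 0 < c. Proof. by rewrite fine_gt0// fD andbT; exact: cell_gt0. Qed.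
Let me z : cmeas D (ez A z). Proof. exact: cmeas_expo. Qed.

Let Gj_L2 b F j : L2 mu D (Gj b F j).
Proof. exact: (trig_sum_L2 mD fD me (@sqnormc_ez _ _ A)). Qed.

Let Gj_norm b F :
  (\sum_j normL2 mu D (Gj b F j) = (c * \sum_(p <- F) sqnormc (b p))%:E)%E.
Proof.
rewrite (partition_big (fun p : I => p.1) xpredT)//= mulr_sumr -sumEFin.
apply: eq_bigr => j _; rewrite (rnormL2E (Gj_L2 b F j)).
rewrite (parseval mD fD me (@sqnormc_ez _ _ A) c0 (ez_orth uA))//.
congr (_ * _)%:E; rewrite big_map big_filter.
by apply: eq_bigr => -[j' l] /= /eqP <-; rewrite /bj zofK.
Qed.

Let cmeas_S (E : set T) b F : cmeas E (S b F).
Proof.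
by apply: cmeas_sum => p; apply: cmeasM; [exact: cmeas_cst|exact: cmeas_expo].
Qed.

Let S_rel b F x : D x -> #|Sx x| = k -> forall i, i \in Sx x ->
  S b F (x - la i) = \sum_j expo (a j) (x - la i) * Gj b F j x.
Proof.
move=> _ _ i _; rewrite S_decomp; apply: eq_bigr => j _.
by rewrite Gj_periodic.
Qed.

(** The interpolated components are in L^2(D) by [comparison_lower]. Their Fourier coefficients are
    the required ones, because [comparison_upper] carries the approximation of all components back
    to Omega. *)
Let expansion (f : T -> R[i]) : L2 mu Om f ->
  exists b : I -> R[i], expands_as Omega freq f b.
Proof.
move=> [mf f2].
have mg j : cmeas D (interp f j) by exact: cmeas_interp.
have rel x : D x -> #|Sx x| = k -> forall i, i \in Sx x ->
    f (x - la i) = \sum_j expo (a j) (x - la i) * interp f j x.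
  by move=> _; exact: interpP.
have g2 j : L2 mu D (interp f j).
  split; first exact: mg.
  apply: (@le_lt_trans _ _ (\sum_j normL2 mu D (interp f j))%E).
    rewrite (bigD1 j)//= leeDl//; apply: sume_ge0 => j' _; exact: normL2_ge0.
  apply: le_lt_trans (comparison_lower mf mg rel) _.
  by rewrite lte_mul_pinfty// lee_fin !mulr_ge0.
pose b (p : I) := coef mu D (ez A) (interp f p.1) (zof p.2).
exists b => eps eps0.
(* [comparison_upper] costs a factor n k, and k components contribute errors below eps / M; the
   summand 1 keeps M positive and the final inequality strict. *)
pose M : R := 1 + (n%:R * k%:R) * k%:R.
have M1 : 0 < M by rewrite ltr_pwDl// !mulr_ge0.
have eM : 0 < eps / M by rewrite divr_gt0.
have /choice[F0 HF0] : forall j, exists F0 : seq 'cV[int]_d, forall F,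
    uniq F -> {subset F0 <= F} -> (normL2 mu D (fun x : T =>
      (interp f j x - trig_sum (ez A) (coef mu D (ez A) (interp f j)) F x)%R)
      < (eps / M)%:E)%E.
  by move=> j; have [F0 _ HF0] := cell_fourier uA (g2 j) eM; exists F0.
pose X : {fset I} := seq_fset tt [seq (j, lof z) | j <- enum 'I_k, z <- F0 j].
exists X => F XF.
have lofK z : zof (lof z) = z.
  by have /(congr1 val) := zofK (lof z) => /dlat_inj; apply.
have bjE j : bj b j = coef mu D (ez A) (interp f j).
  by apply/funext => z; rewrite /bj /b /= lofK.
have F0F j : {subset F0 j <= Fj F j}.
  move=> z zF; apply/mapP; exists (j, lof z); last by rewrite /= lofK.
  rewrite mem_filter eqxx /=; apply: (fsubsetP XF); rewrite seq_fsetE.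
  by apply/allpairsPdep; exists j, z; split => //; rewrite mem_enum.
have Gn j : (normL2 mu D (fun x => (interp f j x - Gj b F j x)%R) < (eps / M)%:E)%E.
  by rewrite /Gj bjE; apply: HF0 => //; exact: F0F.
have mG j : cmeas D (fun x => interp f j x - Gj b F j x).
  by apply: cmeasB; [exact: mg|case: (Gj_L2 b F j)].
have mH : cmeas Om (fun x => f x - S b F x).
  by apply: cmeasB => //; exact: cmeas_S.
have rel' x : D x -> #|Sx x| = k -> forall i, i \in Sx x ->
    f (x - la i) - S b F (x - la i) =
    \sum_j expo (a j) (x - la i) * (interp f j x - Gj b F j x).
  move=> Dx xk i iS; rewrite (rel x Dx xk i iS) (S_rel b F Dx xk iS) -sumrB.
  by apply: eq_bigr => j _; rewrite mulrBr.
apply: le_lt_trans (comparison_upper mH mG rel') _.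
apply: (@le_lt_trans _ _ ((n%:R * k%:R)%:E * \sum_(j < k) (eps / M)%:E)%E).
  by apply: lee_wpmul2l; [rewrite lee_fin|apply: lee_sum => j _; rewrite ltW].
rewrite sumEFin sumr_const card_ord -EFinM lte_fin.
set q := eps / M.
have -> : eps = M * q by rewrite mulrC divfK// gt_eqF.
rewrite -[q *+ k]mulr_natr /M mulrDl mul1r.
have -> : n%:R * k%:R * (q * k%:R) = n%:R * k%:R * k%:R * q by ring.
by rewrite ltrDr.
Qed.

Lemma multitile_riesz_basis : exp_riesz_basis Omega freq.
Proof.
(* The comparison constants, increased by 1 to be positive even if n, k or M0 is 0. *)
pose C1 := k%:R * n%:R * M0 + 1; pose C2 := n%:R * k%:R + 1 : R.
have C10 : 0 < C1 by rewrite ltr_wpDl// !mulr_ge0.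
have C20 : 0 < C2 by rewrite ltr_wpDl// mulr_ge0.
apply: (@riesz_basis_of_finite _ _ _ _ _ mO (c / C1) (C2 * c)).
- by rewrite divr_gt0.
- by rewrite mulr_gt0.
- move=> b F; have := comparison_lower (cmeas_S Om b F)
    (fun j => (Gj_L2 b F j).1) (S_rel b F).
  rewrite Gj_norm => H.
  rewrite -(@lee_pmul2l _ C1%:E)// -EFinM mulrA (mulrC C1) divfK ?gt_eqF//.
  apply: le_trans H _; apply: lee_wpmul2r; first exact: normL2_ge0.
  by rewrite lee_fin lerDl.
- move=> b F; apply: le_trans (comparison_upper (cmeas_S Om b F)
    (fun j => (Gj_L2 b F j).1) (S_rel b F)) _.
  rewrite Gj_norm -EFinM lee_fin -[leRHS]mulrA ler_wpM2r ?lerDl//.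
  by rewrite mulr_ge0 ?(ltW c0)//; apply: sumr_ge0 => p _; exact: sqnormc_ge0.
- exact: expansion.
Qed.

End multitile.

Theorem theorem1 (R : realType) (d : nat) (L : set 'cV[R]_d)
    (hL : is_lattice L) (k : nat) (hk : (0 < k)%N) :
  exists a : 'I_k -> 'cV[R]_d,
    forall Ls : set 'cV[R]_d, is_dual_lattice L Ls ->
    forall Omega : set 'cV[R]_d,
      bounded_set Omega ->
      measurable (Omega : set (lebesgue_space R d)) ->
      tiles_at_level k L Omega ->
      exp_riesz_basis Omega (fun p : 'I_k * set_type Ls => a p.1 + val p.2).
Proof.
have [A0 uA0 LE] := hL; have [v v_inj] := lattice_character_inj uA0.
exists (fun j => (j : nat)%:R *: v) => _ [A uA [LA ->]] Omega bO mO tO.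
have [s us sO] := crd_bounded_finite uA (bounded_crd_bounded A bO).
(* The basis A describing the dual lattice may differ from A0, from which v was built. Injectivity
   of the character concerns only the set L, so it passes from one basis to the other. *)
rewrite -LE LA in v_inj; rewrite LA in tO.
exact: (multitile_riesz_basis uA v_inj mO tO us sO).
Qed.
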